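(* Let $e_1,e_2,e_3\in\mathbb{C}$ be pairwise distinct and let $L\subset\mathfrak{R}_{e_1,e_2,e_3}$ be a Lie subalgebra of finite codimension. Then the associative algebra $\mathcal{I}(L)$ is commutative and is isomorphic to the field $Q_{e_1,e_2,e_3}$.
   Context: Work over $\mathbb{C}$. Let $E_{e_1,e_2,e_3}=\mathbb{C}[v_1,v_2,v_3]/I$, where $I$ is the ideal generated by $v_i^2-v_j^2+e_i-e_j$, $i,j=1,2,3$ (an integral domain when the $e_i$ are pairwise distinct), with $\hat v_i$ the image of $v_i$. Let $\alpha_1,\alpha_2,\alpha_3$ be a basis of $\mathfrak{so}_3(\mathbb{C})$ with $[\alpha_1,\alpha_2]=\alpha_3$, $[\alpha_2,\alpha_3]=\alpha_1$, $[\alpha_3,\alpha_1]=\alpha_2$; $\mathfrak{so}_3(\mathbb{C})\otimes E_{e_1,e_2,e_3}$ has bracket $[\alpha\otimes h_1,\beta\otimes h_2]=[\alpha,\beta]\otimes h_1h_2$, and $\mathfrak{R}_{e_1,e_2,e_3}$ is its Lie subalgebra generated by $\alpha_i\otimes\hat v_i$, $i=1,2,3$. Let $z=\hat v_1^2+e_1$ $(=\hat v_2^2+e_2=\hat v_3^2+e_3)$ and $y=\hat v_1\hat v_2\hat v_3$; $Q_{e_1,e_2,e_3}$ is the subfield of the fraction field of $E_{e_1,e_2,e_3}$ generated by $z$ and $y$ (it is isomorphic to the function field of the elliptic curve $y^2=(z-e_1)(z-e_2)(z-e_3)$). For a Lie algebra $\mathfrak{L}$, an admissible pair is $(h,\mathfrak{h})$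 with $\mathfrak{h}\subset\mathfrak{L}$ a Lie subalgebra of finite codimension and $h\colon\mathfrak{h}\to\mathfrak{L}$ linear with $h([p_1,p_2])=[h(p_1),p_2]=[p_1,h(p_2)]$ for all $p_1,p_2\in\mathfrak{h}$. Two admissible pairs $(h,\mathfrak{h}),(\tilde h,\tilde{\mathfrak{h}})$ are equivalent if $h$ and $\tilde h$ agree on some subalgebra of finite codimension contained in $\mathfrak{h}\cap\tilde{\mathfrak{h}}$. $\mathcal{I}(\mathfrak{L})$ is the set of equivalence classes, an associative algebra with $c[(h,\mathfrak{h})]=[(ch,\mathfrak{h})]$, $[(h_1,\mathfrak{h}_1)]+[(h_2,\mathfrak{h}_2)]=[(h_1+h_2,\mathfrak{h}_1\cap\mathfrak{h}_2)]$, and $[(h_1,\mathfrak{h}_1)]\cdot[(h_2,\mathfrak{h}_2)]=[(h_1\circ h_2,\hat{\mathfrak{h}})]$ with $\hat{\mathfrak{h}}=\{w\in\mathfrak{h}_1\cap\mathfrak{h}_2: h_2(w)\in\mathfrak{h}_1\}$. *)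

(* Defs.v *)
From HB Require Import structures.
From mathcomp Require Import all_boot all_order all_algebra.
From mathcomp Require Import complex boolp.
From mathcomp Require Import Rstruct.
Import GRing.Theory Num.Theory.
Set Implicit Arguments. Unset Strict Implicit. Unset Printing Implicit Defensive.
Local Open Scope ring_scope.
Local Open Scope quotient_scope.

Notation CC := (Rdefinitions.R)[i].
Notation PP := ({poly {poly {poly CC}}}).

Definition pv1 : PP := ((('X : {poly CC})%:P) : {poly {poly CC}})%:P.
Definition pv2 : PP := (('X : {poly {poly CC}}))%:P.
Definition pv3 : PP := 'X.
Definition pcst (c : CC) : PP := ((c%:P)%:P)%:P.

Definition gen (e1 e2 e3 : CC) (i : 'I_3) : PP :=
  [:: pv1 ^+ 2 + pcst e1; pv2 ^+ 2 + pcst e2; pv3 ^+ 2 + pcst e3]`_i.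

Definition Ipred (e1 e2 e3 : CC) : pred PP := fun p =>
  `[< exists a : 'I_3 -> 'I_3 -> PP,
      p = \sum_(i < 3) \sum_(j < 3) a i j * (gen e1 e2 e3 i - gen e1 e2 e3 j) >].

Definition pev (x1 x2 x3 : CC) (p : PP) : CC :=
  ((p.[((x3%:P)%:P)]).[x2%:P]).[x1].

Lemma pevM x1 x2 x3 p q : pev x1 x2 x3 (p * q) = pev x1 x2 x3 p * pev x1 x2 x3 q.
Proof. by rewrite /pev !hornerM. Qed.
Lemma pevD x1 x2 x3 p q : pev x1 x2 x3 (p + q) = pev x1 x2 x3 p + pev x1 x2 x3 q.
Proof. by rewrite /pev !hornerD. Qed.
Lemma pevB x1 x2 x3 p q : pev x1 x2 x3 (p - q) = pev x1 x2 x3 p - pev x1 x2 x3 q.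
Proof. by rewrite /pev !hornerD !hornerN. Qed.

Lemma Ipred_closed e1 e2 e3 : idealr_closed (Ipred e1 e2 e3).
Proof.
split.
- apply/asboolP; exists (fun _ _ => 0).
  by rewrite big1 // => i _; rewrite big1 // => j _; rewrite mul0r.
- apply/negP => /asboolP [a Ha].
  pose x i := sqrtC (- [:: e1; e2; e3]`_i).
  have key (i : 'I_3) : pev (x 0) (x 1) (x 2) (gen e1 e2 e3 i) = 0.
    case: i => [[|[|[|k]]] Hk]; rewrite /gen /= ?pevD /pev ?hornerE /x /= ?sqrtCK ?addNr //.
  have hs (F : 'I_3 -> PP) : pev (x 0) (x 1) (x 2) (\sum_(i < 3) F i) = \sum_(i < 3) pev (x 0) (x 1) (x 2) (F i).
    by rewrite !big_ord_recr !big_ord0 /= !pevD /pev !hornerE.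
  have h1 : pev (x 0) (x 1) (x 2) 1 = 1 by rewrite /pev !hornerE.
  move: (congr1 (pev (x 0) (x 1) (x 2)) Ha); rewrite h1 hs big1; first by move/eqP; rewrite oner_eq0.
  move=> i _; by rewrite hs big1 // => j _; rewrite pevM pevB !key subr0 mulr0.
- move=> c p q /asboolP [a Ha] /asboolP [b Hb]; apply/asboolP.
  exists (fun i j => c * a i j + b i j).
  rewrite Ha Hb mulr_sumr -big_split /=; apply: eq_bigr => i _.
  rewrite mulr_sumr -big_split /=; apply: eq_bigr => j _.
  by rewrite mulrDl mulrA.
Qed.

HB.instance Definition _ (e1 e2 e3 : CC) :=
  isIdealr.Build PP (Ipred e1 e2 e3) (Ipred_closed e1 e2 e3).

Definition EE (e1 e2 e3 : CC) := {ideal_quot (Ipred e1 e2 e3 : idealr PP)}.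

Section LieData.
Variables e1 e2 e3 : CC.
Local Notation E := (EE e1 e2 e3).

Definition cE (c : CC) : E := \pi_E (pcst c).
Definition vh1 : E := \pi_E pv1.
Definition vh2 : E := \pi_E pv2.
Definition vh3 : E := \pi_E pv3.
Definition zE : E := vh1 ^+ 2 + cE e1.
Definition yE : E := vh1 * vh2 * vh3.

(** so_3(C) (x) E : the element  alpha_1 (x) a1 + alpha_2 (x) a2 + alpha_3 (x) a3
    is represented by its coordinates (a1, a2, a3) in the basis alpha_1, alpha_2, alpha_3 *)
Record tens := Tens { t1 : E; t2 : E; t3 : E }.

Definition tzero : tens := Tens 0 0 0.
Definition tadd (x y : tens) : tens := Tens (t1 x + t1 y) (t2 x + t2 y) (t3 x + t3 y).
Definition tscale (c : CC) (x : tens) : tens :=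
  Tens (cE c * t1 x) (cE c * t2 x) (cE c * t3 x).
(** bracket determined by [a1,a2]=a3, [a2,a3]=a1, [a3,a1]=a2 and
    [alpha (x) h1, beta (x) h2] = [alpha,beta] (x) h1 h2 *)
Definition tbr (x y : tens) : tens :=
  Tens (t2 x * t3 y - t3 x * t2 y)
       (t3 x * t1 y - t1 x * t3 y)
       (t1 x * t2 y - t2 x * t1 y).

Definition tgen1 : tens := Tens vh1 0 0.
Definition tgen2 : tens := Tens 0 vh2 0.
Definition tgen3 : tens := Tens 0 0 vh3.

Definition is_subspace (S : tens -> Prop) : Prop :=
  [/\ S tzero, (forall x y, S x -> S y -> S (tadd x y))
    & (forall c x, S x -> S (tscale c x))].

Definition is_subalg (S : tens -> Prop) : Prop :=
  is_subspace S /\ (forall x y, S x -> S y -> S (tbr x y)).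

Definition RR (x : tens) : Prop :=
  forall S, is_subalg S -> S tgen1 -> S tgen2 -> S tgen3 -> S x.

Definition fincodim (A B : tens -> Prop) : Prop :=
  exists (n : nat) (ws : 'I_n -> tens), (forall i, A (ws i)) /\
    forall x, A x -> exists (cs : 'I_n -> CC) (y : tens),
      B y /\ x = tadd (\big[tadd/tzero]_(i < n) tscale (cs i) (ws i)) y.

Definition admissible (L : tens -> Prop) (h : tens -> tens) (H : tens -> Prop) : Prop :=
  (
     is_subalg H
     /\ (forall x, H x -> L x)
     /\ fincodim L H
     /\ (forall x, H x -> L (h x))
     /\ (forall x y, H x -> H y -> h (tadd x y) = tadd (h x) (h y))
     /\ (forall c x, H x -> h (tscale c x) = tscale c (h x))
     /\ (forall p1 p2, H p1 -> H p2 ->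
         h (tbr p1 p2) = tbr (h p1) p2 /\ h (tbr p1 p2) = tbr p1 (h p2))).

Definition ap_equiv (L : tens -> Prop) (h : tens -> tens) (H : tens -> Prop)
    (h' : tens -> tens) (H' : tens -> Prop) : Prop :=
  exists K : tens -> Prop, [/\ is_subalg K, (forall x, K x -> H x /\ H' x),
    fincodim L K & (forall x, K x -> h x = h' x)].

(** the operations of I(L), on representatives *)
Definition hscale (c : CC) (h : tens -> tens) : tens -> tens := fun x => tscale c (h x).
Definition hsum (h1 h2 : tens -> tens) : tens -> tens := fun x => tadd (h1 x) (h2 x).
Definition Hcap (H1 H2 : tens -> Prop) : tens -> Prop := fun x => H1 x /\ H2 x.
Definition hcomp (h1 h2 : tens -> tens) : tens -> tens := fun x => h1 (h2 x).
Definition Hhat (H1 H2 : tens -> Prop) (h2 : tens -> tens) : tens -> Prop :=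
  fun w => [/\ H1 w, H2 w & H1 (h2 w)].

Definition frac : Type := (E * E)%type.
Definition fvalid (f : frac) : Prop := f.2 != 0.
Definition feq (f g : frac) : Prop := f.1 * g.2 = g.1 * f.2.
Definition fadd (f g : frac) : frac := (f.1 * g.2 + g.1 * f.2, f.2 * g.2).
Definition fopp (f : frac) : frac := (- f.1, f.2).
Definition fmul (f g : frac) : frac := (f.1 * g.1, f.2 * g.2).
Definition finv (f : frac) : frac := (f.2, f.1).
Definition fcst (c : CC) : frac := (cE c, 1).

Definition frac_subfield (S : frac -> Prop) : Prop :=
  (
     (forall f, S f -> fvalid f)
     /\ (forall f g, S f -> fvalid g -> feq f g -> S g)
     /\ (forall c, S (fcst c))
     /\ (forall f g, S f -> S g -> S (fadd f g))
     /\ (forall f, S f -> S (fopp f))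
     /\ (forall f g, S f -> S g -> S (fmul f g))
     /\ (forall f, S f -> f.1 != 0 -> S (finv f))).

Definition Qmem (f : frac) : Prop :=
  fvalid f /\
  forall S, frac_subfield S -> S (zE, 1) -> S (yE, 1) -> S f.

Definition IL_iso_Q (L : tens -> Prop)
    (Phi : (tens -> tens) -> (tens -> Prop) -> frac) : Prop :=
  (
     (forall h H, admissible L h H -> Qmem (Phi h H))
     /\ (forall h H h' H', admissible L h H -> admissible L h' H' ->
         (ap_equiv L h H h' H' <-> feq (Phi h H) (Phi h' H')))
     /\ (forall f, Qmem f -> exists h H, admissible L h H /\ feq (Phi h H) f)
     /\ (forall c h H, admissible L h H ->
         feq (Phi (hscale c h) H) (fmul (fcst c) (Phi h H)))
     /\ (forall h1 H1 h2 H2, admissible L h1 H1 -> admissible L h2 H2 ->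
         feq (Phi (hsum h1 h2) (Hcap H1 H2)) (fadd (Phi h1 H1) (Phi h2 H2)))
     /\ (forall h1 H1 h2 H2, admissible L h1 H1 -> admissible L h2 H2 ->
         feq (Phi (hcomp h1 h2) (Hhat H1 H2 h2)) (fmul (Phi h1 H1) (Phi h2 H2)))
     /\ feq (Phi id L) (1, 1)).

End LieData.

(* Main.v *)
Require Import Defs.
From HB Require Import structures.
From mathcomp Require Import all_boot all_order all_algebra.
From mathcomp Require Import complex boolp Rstruct.
From mathcomp Require Import ring.
Import GRing.Theory Num.Theory.
Local Open Scope ring_scope.
Set Implicit Arguments.
Unset Strict Implicit.

(* With A = C[z, y] inside E, the algebra R is the sum of the alpha_i (x) M_i, where
   M_i = v_i C[z] + v_j v_k C[z] is an A-module.  A subalgebra H of finite codimension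
   meets each line alpha_i (x) v_i C[z], and evaluating h([p1, p2]) on such elements
   alpha_1 (x) x, alpha_2 (x) y shows that an admissible h is multiplication by a fixed
   fraction a/x in Q; uniqueness of this fraction gives the injection of I(L) into Q.
   Conversely, for a, b in A with b <> 0, multiplication by a/b is defined on
   {x in L | a x in b L}, which has finite codimension because b R contains N(b) R,
   N(b) in C[z] being the norm of b.  That E is a domain comes from its norm to C[v_1]:
   v_1^2 + c, v_1^2 + d and their product are not squares. *)

(** L is an arbitrary subalgebra of finite codimension, so it need not be stable under A, and the
    maps h are linear on their domains only. Codimension must therefore be controlled under
    preimages by partially linear maps; counting linear dependencies does this without choosing
    complements. An admissible h is forced to be scalar because [h(p), p] = [p, h(p)] makes h(p)
    commute with p, and over the fraction field of E the centralizer of a nonzero element of so_3 is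
    the line through it. Pairing p with other elements then shows that the scalar does not depend on
    p. The norm N(b) of a nonzero b in A is nonzero because (z - e_1)(z - e_2)(z - e_3) is not a
    square in C(z). *)

(** * Finite codimension of subspaces *)

Section FiniteCodimension.
Variable F : fieldType.

Definition subspace_pred (V : lmodType F) (S : V -> Prop) : Prop :=
  [/\ S 0, (forall x y, S x -> S y -> S (x + y))
    & (forall c x, S x -> S (c *: x))].

Definition finite_codim (V : lmodType F) (A B : V -> Prop) : Prop :=
  exists (n : nat) (ws : 'I_n -> V), (forall i, A (ws i)) /\
    forall x, A x -> exists (cs : 'I_n -> F) (y : V),
      B y /\ x = \sum_(i < n) cs i *: ws i + y.

(** For subspaces, the case [n.+1] amounts to dim A/(A meet B) <= n. Unlike the spanning form, it
    passes to preimages directly: a dependency between the images is one between the vectors. *)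
Definition dependent_mod (V : lmodType F) (n : nat) (A B : V -> Prop) : Prop :=
  forall f : 'I_n -> V, (forall i, A (f i)) ->
    exists c : 'rV[F]_n, c != 0 /\ B (\sum_(i < n) c 0 i *: f i).

Lemma subspace_sum (V : lmodType F) (S : V -> Prop) (I : Type) (r : seq I)
    (c : I -> F) (w : I -> V) :
  subspace_pred S -> (forall i, S (w i)) -> S (\sum_(i <- r) c i *: w i).
Proof.
by case=> S0 SD SZ Sw; elim/big_ind: _ => // i _; apply: SZ.
Qed.

Lemma finite_codim_dependent (V : lmodType F) (A B : V -> Prop) :
  subspace_pred B -> finite_codim A B -> exists n, dependent_mod n.+1 A B.
Proof.
move=> subB [n [ws [_ gen]]]; exists n => f Af.
have {gen} /choice [cs /choice [y Hy]] : forall i : 'I_n.+1, exists cs : 'I_n -> F,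
    exists y, B y /\ f i = \sum_(j < n) cs j *: ws j + y.
  by move=> i; apply: gen.
pose M := \matrix_(i < n.+1, j < n) cs i j.
(* The matrix has one more row than columns, so some nonzero combination of its rows vanishes; it
   cancels every [ws] component. *)
have kM : kermx M != 0.
  by rewrite kermx_eq0 /row_free neq_ltn ltnS rank_leq_col.
exists (nz_row (kermx M)); split; first by rewrite nz_row_eq0.
set c := nz_row _.
have cM : c *m M = 0 by apply/sub_kermxP/nz_row_sub.
suff -> : \sum_(i < n.+1) c 0 i *: f i = \sum_(i < n.+1) c 0 i *: y i.
  by apply: subspace_sum => // i; case: (Hy i).
under eq_bigr => i _ do rewrite (proj2 (Hy i)) scalerDr.
rewrite big_split /= -[RHS]add0r; congr (_ + _).
under eq_bigr => i _ do rewrite scaler_sumr.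
rewrite exchange_big big1 //= => j _.
under eq_bigr => i _ do rewrite scalerA.
rewrite -scaler_suml.
have -> : \sum_(i < n.+1) c 0 i * cs i j = (c *m M) 0 j.
  by rewrite mxE; apply: eq_bigr => i _; rewrite mxE.
by rewrite cM mxE scale0r.
Qed.

(* A largest family independent modulo B spans A modulo B. *)
Lemma dependent_finite_codim (V : lmodType F) (n : nat) (A B : V -> Prop) :
  subspace_pred B -> dependent_mod n.+1 A B -> finite_codim A B.
Proof.
move=> [B0 BD BZ]; elim: n => [|n IHn] depA.
  exists 0%N, (fun=> 0); split=> [[]//|x Ax].
  have [c [c0]] := depA (fun=> x) (fun=> Ax).
  rewrite big_ord_recl big_ord0 addr0 => Bcx.
  exists (fun=> 0), x; rewrite big_ord0 add0r; split=> //.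
  have c00 : c 0 0 != 0.
    by apply: contra_neq c0 => c00; apply/rowP => i; rewrite ord1 c00 mxE.
  by rewrite -[x]scale1r -(mulVf c00) -scalerA; apply: BZ.
have [/IHn //|ndep] := EM (dependent_mod n.+1 A B).
have [f [Af indf]] : exists f : 'I_n.+1 -> V, (forall i, A (f i)) /\
    forall c : 'rV[F]_n.+1, c != 0 -> ~ B (\sum_(i < n.+1) c 0 i *: f i).
  apply: contra_notP ndep => nf f Af; apply: contra_notP nf => nc.
  by exists f; split=> // c c0 Bc; apply: nc; exists c.
exists n.+1, f; split=> // x Ax.
(* The family f is extended by x in last position, so that [c 0 ord_max] is the coefficient of x.
   Independence of f makes it nonzero, and x can be solved for. *)
have [|c [c0]] := depA (fun i => if unlift ord_max i is Some j then f j else x).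
  by move=> i; case: unliftP.
rewrite big_ord_recr /= unlift_none.
under eq_bigr => i _.
  have -> : widen_ord (leqnSn n.+1) i = lift ord_max i.
    by apply: val_inj; rewrite /= /bump leqNgt ltn_ord.
  rewrite liftK.
  over.
move=> Bc.
have cx : c 0 ord_max != 0.
  apply/eqP => cx; pose d : 'rV[F]_n.+1 := \row_i c 0 (lift ord_max i).
  have d0 : d != 0.
    apply: contra_neq c0 => d0; apply/rowP => i; rewrite mxE.
    case: (unliftP ord_max i) => [j|] -> //.
    by move/rowP/(_ j): d0; rewrite !mxE.
  apply: (indf d d0); move: Bc; rewrite cx scale0r addr0.
  by congr B; apply: eq_bigr => i _; rewrite mxE.
exists (fun i => - (c 0 ord_max)^-1 * c 0 (lift ord_max i)).
exists ((c 0 ord_max)^-1 *: (\sum_(i < n.+1) c 0 (lift ord_max i) *: f i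
  + c 0 ord_max *: x)); split; first exact: BZ.
rewrite scalerDr scalerA mulVf // scale1r addrA scaler_sumr -big_split /=.
rewrite big1 ?add0r // => i _.
by rewrite scalerA -scalerDl mulNr addNr scale0r.
Qed.

Lemma finite_codim_fin (V : lmodType F) (I : finType) (ws : I -> V)
    (A B : V -> Prop) :
  (forall i, A (ws i)) ->
  (forall x, A x -> exists (cs : I -> F) (y : V),
     B y /\ x = \sum_i cs i *: ws i + y) ->
  finite_codim A B.
Proof.
move=> Aw gen; exists #|I|, (fun k => ws (enum_val k)); split=> // x /gen.
move=> [cs [y [By ->]]]; exists (fun k => cs (enum_val k)), y; split=> //.
congr (_ + _); rewrite (reindex (fun k : 'I_#|I| => enum_val k)) //=.
by exists enum_rank => i _; rewrite ?enum_valK ?enum_rankK.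
Qed.

Lemma finite_codim_trans (V : lmodType F) (A B C : V -> Prop) :
  (forall x, B x -> A x) ->
  finite_codim A B -> finite_codim B C -> finite_codim A C.
Proof.
move=> BA [n [w [Aw genA]]] [m [u [Bu genB]]].
exists (n + m)%N, (fun i => match split i with inl j => w j | inr k => u k end).
split=> [i|x Ax]; first by case: split => j //; apply: BA.
have [cs [y [By ->]]] := genA x Ax.
have [ds [z [Cz ->]]] := genB y By.
exists (fun i => match split i with inl j => cs j | inr k => ds k end), z.
split=> //; rewrite big_split_ord /= addrA; congr (_ + _ + _).
  by apply: eq_bigr => i _; rewrite (unsplitK (inl i)).
by apply: eq_bigr => i _; rewrite (unsplitK (inr i)).
Qed.

Lemma finite_codim_image (V W : lmodType F) (T : V -> W) (A B : V -> Prop) :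
  (forall x y, T (x + y) = T x + T y) -> (forall c x, T (c *: x) = c *: T x) ->
  finite_codim A B ->
  finite_codim (fun y => exists2 x, A x & y = T x) (fun y => exists2 x, B x & y = T x).
Proof.
move=> TD TZ [n [w [Aw genA]]]; exists n, (fun i => T (w i)); split=> [i|y [x Ax ->]].
  by exists (w i).
have [cs [z [Bz ->]]] := genA x Ax; exists cs, (T z); split; first by exists z.
have T0 : T 0 = 0 by rewrite -(scale0r 0) TZ scale0r.
by rewrite TD (big_morph T TD T0); under [in LHS]eq_bigr => i _ do rewrite TZ.
Qed.

(** Linearity of T is only asked on A, because the map of an admissible pair is linear on its domain
    only. *)
Lemma finite_codim_preim (V W : lmodType F) (T : V -> W) (A : V -> Prop)
    (A' B' : W -> Prop) :
  subspace_pred A -> subspace_pred B' ->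
  (forall x y, A x -> A y -> T (x + y) = T x + T y) ->
  (forall c x, A x -> T (c *: x) = c *: T x) ->
  (forall x, A x -> A' (T x)) ->
  finite_codim A' B' -> finite_codim A (fun x => A x /\ B' (T x)).
Proof.
move=> subA subB' TD TZ TA /(finite_codim_dependent subB') [n dep].
have [A0 AD AZ] := subA; have [B0 BD BZ] := subB'.
have T0 : T 0 = 0 by rewrite -(scale0r 0) TZ // scale0r.
apply: (@dependent_finite_codim _ n).
  split=> [|x y [Ax Bx] [Ay By]|c x [Ax Bx]]; rewrite ?T0 ?TD ?TZ //.
    by split; [apply: AD | apply: BD].
  by split; [apply: AZ | apply: BZ].
move=> f Af; have [|c [c0 Bc]] := dep (T \o f); first by move=> i; apply: TA.
exists c; split=> //; split; first exact: subspace_sum.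
suff -> : T (\sum_(i < n.+1) c 0 i *: f i) = \sum_(i < n.+1) c 0 i *: (T \o f) i by [].
suff [] : A (\sum_(i < n.+1) c 0 i *: f i) /\
  T (\sum_(i < n.+1) c 0 i *: f i) = \sum_(i < n.+1) c 0 i *: (T \o f) i by [].
apply: (big_ind2 (fun x y => A x /\ T x = y)) => //.
  by move=> x _ y _ [Ax <-] [Ay <-]; rewrite TD //; split=> //; apply: AD.
by move=> i _; rewrite TZ //; split=> //; apply: AZ.
Qed.

Lemma finite_codim_cap (V : lmodType F) (A B C : V -> Prop) :
  subspace_pred B -> subspace_pred C -> (forall x, B x -> A x) ->
  finite_codim A B -> finite_codim A C ->
  finite_codim A (fun x => B x /\ C x).
Proof.
move=> subB subC BA AB AC; apply: (finite_codim_trans BA AB).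
exact: (finite_codim_preim (T := id) subB subC _ _ BA AC).
Qed.

End FiniteCodimension.

(** * Non-squares in F[X] and norms of biquadratic extensions *)

Section NonSquares.
Variable F : fieldType.

(* Infinite descent on the order of vanishing at the simple root r. *)
Lemma simple_root_nonsquare (r : F) (d p q : {poly F}) :
  d.[r] != 0 -> p ^+ 2 = (('X - r%:P) * d) * q ^+ 2 -> q = 0.
Proof.
move=> dr; have [n] := ubnP (size q); elim: n => // n IHn in p q *.
rewrite ltnS => szq E.
have [//|q0] := eqVneq q 0.
have Xr0 : 'X - r%:P != 0 by rewrite polyXsubC_eq0.
have /factor_theorem [p' Ep] : root p r.
  move/(congr1 (fun s => s.[r])): E.
  rewrite !hornerM hornerXsubC subrr !mul0r => /eqP.
  by rewrite mulf_eq0 orbb.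
have {}E : ('X - r%:P) * p' ^+ 2 = d * q ^+ 2.
  by apply: (mulfI Xr0); rewrite [RHS]mulrA -E Ep; ring.
have /factor_theorem [q' Eq] : root q r.
  move/(congr1 (fun s => s.[r])): E.
  rewrite !hornerM hornerXsubC subrr !mul0r => /esym/eqP.
  by rewrite mulf_eq0 (negPf dr) /= mulf_eq0 orbb.
have q'0 : q' != 0 by apply: contra_neq q0 => q'0; rewrite Eq q'0 mul0r.
have Eq' : q' = 0.
  apply: (IHn p'); last by apply: (mulfI Xr0); rewrite E Eq; ring.
  by move: szq; rewrite Eq size_Mmonic ?monicXsubC // size_XsubC addn2.
by rewrite Eq' eqxx in q'0.
Qed.

Lemma simple_root_sqr_eq0 (r : F) (d p q : {poly F}) :
  d.[r] != 0 -> p ^+ 2 = (('X - r%:P) * d) * q ^+ 2 -> p = 0 /\ q = 0.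
Proof.
move=> dr E; have q0 := simple_root_nonsquare dr E; split=> //.
by move/eqP: E; rewrite q0 expr0n mulr0 expf_eq0 => /andP[_ /eqP].
Qed.

End NonSquares.

(** Expresses that d is not a square in the field F(X), with denominators cleared. *)
Definition poly_nonsquare (F : fieldType) (d : {poly F}) : Prop :=
  forall p q : {poly F}, p ^+ 2 = d * q ^+ 2 -> p = 0 /\ q = 0.

(* The norm of a0 + a1 sqrt(u) + a2 sqrt(w) + a3 sqrt(u w) down to F[X] is
   (x^2 - u y^2) with x + y sqrt(u) the norm down to F[X][sqrt(u)]. *)
Definition biquad_norm (R : comNzRingType) (u w a0 a1 a2 a3 : R) : R :=
  (a0 ^+ 2 + u * a1 ^+ 2 - w * (a2 ^+ 2 + u * a3 ^+ 2)) ^+ 2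
  - u * (2%:R * (a0 * a1 - w * (a2 * a3))) ^+ 2.

(** Product of the three other conjugates of a0 + a1 v2 + (a2 + a3 v2) v3. The first factor changes
    the sign of v3; the second is the product of the two conjugates in which v2 changes sign. *)
Definition biquad_conj (R : comNzRingType) (v2 v3 a0 a1 a2 a3 : R) : R :=
  (a0 + a1 * v2 - (a2 + a3 * v2) * v3) *
  (a0 ^+ 2 + v2 ^+ 2 * a1 ^+ 2 - v3 ^+ 2 * (a2 ^+ 2 + v2 ^+ 2 * a3 ^+ 2)
   - (2%:R * (a0 * a1 - v3 ^+ 2 * (a2 * a3))) * v2).

Lemma biquad_conjM (R : comNzRingType) (v2 v3 a0 a1 a2 a3 : R) :
  (a0 + a1 * v2 + (a2 + a3 * v2) * v3) * biquad_conj v2 v3 a0 a1 a2 a3 =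
  biquad_norm (v2 ^+ 2) (v3 ^+ 2) a0 a1 a2 a3.
Proof. rewrite /biquad_conj /biquad_norm; ring. Qed.

(** As u is not a square, both components of the norm down to F[X][sqrt(u)] vanish: a0^2 + u a1^2 =
    w (a2^2 + u a3^2) and a0 a1 = w a2 a3. Squaring the first and subtracting 4 u times the square
    of the second gives a0^2 - u a1^2 = w (a2^2 - u a3^2) up to sign. Combined with the first
    equation, the plus sign leaves two relations p^2 = w q^2, the minus sign two relations p^2 = u w
    q^2. *)
Lemma biquad_norm_eq0 (F : fieldType) (u w a0 a1 a2 a3 : {poly F}) :
  2%:R != 0 :> F -> u != 0 -> w != 0 ->
  poly_nonsquare u -> poly_nonsquare w -> poly_nonsquare (u * w) ->
  biquad_norm u w a0 a1 a2 a3 = 0 ->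
  [/\ a0 = 0, a1 = 0, a2 = 0 & a3 = 0].
Proof.
move=> two u0 w0 nu nw nuw /eqP; rewrite subr_eq0 => /eqP/nu [E1 E2].
have two' : 2%:R != 0 :> {poly F} by rewrite -polyC_natr polyC_eq0.
have {}E2 : a0 * a1 = w * (a2 * a3).
  by move/eqP: E2; rewrite mulf_eq0 (negPf two') /= subr_eq0 => /eqP.
have /eqP : (a0 ^+ 2 - u * a1 ^+ 2) ^+ 2 = (w * (a2 ^+ 2 - u * a3 ^+ 2)) ^+ 2.
  have -> : (a0 ^+ 2 - u * a1 ^+ 2) ^+ 2 =
    (a0 ^+ 2 + u * a1 ^+ 2) ^+ 2 - 4%:R * u * (a0 * a1) ^+ 2 by ring.
  have /eqP -> : a0 ^+ 2 + u * a1 ^+ 2 == w * (a2 ^+ 2 + u * a3 ^+ 2).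
    by rewrite -subr_eq0 E1.
  rewrite E2; ring.
rewrite eqf_sqr => /orP[] /eqP E3.
  have [-> ->] : a0 = 0 /\ a2 = 0.
    apply: nw; apply: (mulfI two').
    have -> : 2%:R * a0 ^+ 2 =
     (a0 ^+ 2 + u * a1 ^+ 2 - w * (a2 ^+ 2 + u * a3 ^+ 2)) + (a0 ^+ 2 - u * a1 ^+ 2)
     + w * (a2 ^+ 2 + u * a3 ^+ 2) by ring.
    rewrite E1 E3; ring.
  have [-> ->] // : a1 = 0 /\ a3 = 0.
  apply: nw; apply: (mulfI two'); apply: (mulfI u0).
  have -> : u * (2%:R * a1 ^+ 2) =
   (a0 ^+ 2 + u * a1 ^+ 2 - w * (a2 ^+ 2 + u * a3 ^+ 2)) - (a0 ^+ 2 - u * a1 ^+ 2)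
   + w * (a2 ^+ 2 + u * a3 ^+ 2) by ring.
  rewrite E1 E3; ring.
have [-> ->] : a0 = 0 /\ a3 = 0.
  apply: nuw; apply: (mulfI two').
  have -> : 2%:R * a0 ^+ 2 =
   (a0 ^+ 2 + u * a1 ^+ 2 - w * (a2 ^+ 2 + u * a3 ^+ 2)) + (a0 ^+ 2 - u * a1 ^+ 2)
   + w * (a2 ^+ 2 + u * a3 ^+ 2) by ring.
  rewrite E1 E3; ring.
have [/eqP] : u * a1 = 0 /\ a2 = 0.
  apply: nuw; apply: (mulfI two').
  have -> : 2%:R * (u * a1) ^+ 2 =
   u * ((a0 ^+ 2 + u * a1 ^+ 2 - w * (a2 ^+ 2 + u * a3 ^+ 2)) - (a0 ^+ 2 - u * a1 ^+ 2)
   + w * (a2 ^+ 2 + u * a3 ^+ 2)) by ring.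
  rewrite E1 E3; ring.
by rewrite mulf_eq0 (negPf u0) /= => /eqP -> ->.
Qed.

Lemma poly_eq0_pointwise (F : numFieldType) (p : {poly F}) :
  (forall t, p.[t] = 0) -> p = 0.
Proof.
move=> p0; apply: (@roots_geq_poly_eq0 _ p [seq i%:R | i <- iota 0 (size p)]).
- by apply/allP => t _; rewrite /root p0.
- by rewrite map_inj_uniq ?iota_uniq // => i j /eqP; rewrite eqr_nat => /eqP.
- by rewrite size_map size_iota.
Qed.

Lemma quadratic_rep (A E : comNzRingType) (pi : {rmorphism {poly A} -> E}) (w : A) :
  pi 'X ^+ 2 = pi w%:P ->
  forall p, exists b0 b1 : A, pi p = pi b0%:P + pi b1%:P * pi 'X.
Proof.
move=> Ew; elim/poly_ind => [|p c [b0 [b1 IHp]]].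
  by exists 0, 0; rewrite !rmorph0 mul0r addr0.
exists (w * b1 + c), b0.
rewrite polyCD polyCM !(rmorphD pi) !(rmorphM pi) IHp -Ew.
by move: (pi _) (pi _) (pi _) (pi _) => V x0 x1 x2; ring.
Qed.

Lemma biquad_rep (R E : comNzRingType) (pi : {rmorphism {poly {poly {poly R}}} -> E})
    (u w : {poly R}) :
  pi 'X%:P ^+ 2 = pi u%:P%:P -> pi 'X ^+ 2 = pi w%:P%:P ->
  forall p, exists a0 a1 a2 a3 : {poly R},
    pi p = pi a0%:P%:P + pi a1%:P%:P * pi 'X%:P
           + (pi a2%:P%:P + pi a3%:P%:P * pi 'X%:P) * pi 'X.
Proof.
move=> Eu Ew p; have [b0 [b1 ->]] := quadratic_rep Ew p.
have [a0 [a1 /= ->]] := @quadratic_rep _ _ (pi \o polyC) u Eu b0.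
have [a2 [a3 /= ->]] := @quadratic_rep _ _ (pi \o polyC) u Eu b1.
by exists a0, a1, a2, a3.
Qed.

Lemma biquad_norm_morph (R S : comNzRingType) (f : {rmorphism R -> S})
    (u w a0 a1 a2 a3 : R) :
  f (biquad_norm u w a0 a1 a2 a3) =
  biquad_norm (f u) (f w) (f a0) (f a1) (f a2) (f a3).
Proof.
by rewrite /biquad_norm !(rmorphXn, rmorph_nat, rmorphB, rmorphD, rmorphM).
Qed.

(** * Biquadratic extensions of F[X] that are domains *)

Section NonSquareQuadratics.
Variable F : numClosedFieldType.

Lemma shifted_square_factor (c : F) :
  exists2 r, 'X^2 + c%:P = ('X - r%:P) * ('X + r%:P) & r ^+ 2 = - c.
Proof.
exists (sqrtC (- c)); last exact: sqrtCK.
by rewrite -subr_sqr -rmorphXn /= sqrtCK rmorphN opprK.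
Qed.

Lemma nonsquare_X2D (c : F) : c != 0 -> poly_nonsquare ('X^2 + c%:P).
Proof.
have [r -> r2] := shifted_square_factor c => c0 p q.
apply: (@simple_root_sqr_eq0 F r ('X + r%:P)); rewrite !hornerE -mulr2n -mulr_natl mulf_neq0 ?pnatr_eq0 //.
by rewrite -sqrf_eq0 r2 oppr_eq0.
Qed.

(** A root r of X^2 + c is a simple root of the product: r differs from -r as c is nonzero, and r^2
    + d = d - c is nonzero. *)
Lemma nonsquare_X2DM (c d : F) : c != 0 -> c != d ->
  poly_nonsquare (('X^2 + c%:P) * ('X^2 + d%:P)).
Proof.
have [r -> r2] := shifted_square_factor c => c0 cd p q.
rewrite -(mulrA _ ('X + _)).
apply: (@simple_root_sqr_eq0 F r (('X + r%:P) * ('X^2 + d%:P))); rewrite hornerM mulf_neq0 //.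
  rewrite !hornerE -mulr2n -mulr_natl mulf_neq0 ?pnatr_eq0 //.
  by rewrite -sqrf_eq0 r2 oppr_eq0.
by rewrite !hornerE -?expr2 r2 addrC subr_eq0 eq_sym.
Qed.

Lemma size_X2D (c : F) : size ('X^2 + c%:P) = 3%N.
Proof. by rewrite size_polyDl ?size_polyXn // size_polyC; case: eqP. Qed.

(** This is what keeps the norm p^2 - f q^2 of p + y q, where y^2 = f(z) is the equation of the
    curve, from vanishing on nonzero elements. *)
Lemma nonsquare_cubic (e1 e2 e3 : F) : e1 != e2 -> e1 != e3 ->
  poly_nonsquare (('X - e1%:P) * ('X - e2%:P) * ('X - e3%:P)).
Proof.
move=> e12 e13 p q; rewrite -mulrA; apply: (@simple_root_sqr_eq0 F e1 (('X - e2%:P) * ('X - e3%:P))).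
by rewrite hornerM !hornerXsubC mulf_neq0 // subr_eq0.
Qed.

(** A nonzero x has a nonzero multiple in the image of F[X], namely its norm. Multiplying x y = 0 by
    the conjugates of both factors would thus give two nonzero polynomials with product zero. *)
Lemma biquad_domain (E : comNzRingType) (iota : {rmorphism {poly F} -> E})
    (v2 v3 : E) (c d : F) :
  c != 0 -> d != 0 -> c != d -> (forall p, iota p = 0 -> p = 0) ->
  v2 ^+ 2 = iota ('X^2 + c%:P) -> v3 ^+ 2 = iota ('X^2 + d%:P) ->
  (forall x, exists a0 a1 a2 a3,
    x = iota a0 + iota a1 * v2 + (iota a2 + iota a3 * v2) * v3) ->
  forall x y : E, x * y = 0 -> x = 0 \/ y = 0.
Proof.
move=> c0 d0 cd iota_inj v2E v3E rep.
have conj (x : E) : x != 0 -> exists y n, x * y = iota n /\ n != 0.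
  have [a0 [a1 [a2 [a3 ->]]]] := rep x => x0.
  exists (biquad_conj v2 v3 (iota a0) (iota a1) (iota a2) (iota a3)).
  exists (biquad_norm ('X^2 + c%:P) ('X^2 + d%:P) a0 a1 a2 a3); split.
    by rewrite biquad_conjM v2E v3E biquad_norm_morph.
  apply: contra_neq x0 => /biquad_norm_eq0 [].
  - by rewrite pnatr_eq0.
  - by rewrite -size_poly_eq0 size_X2D.
  - by rewrite -size_poly_eq0 size_X2D.
  - exact: nonsquare_X2D.
  - exact: nonsquare_X2D.
  - exact: nonsquare_X2DM.
  by move=> -> -> -> ->; rewrite !rmorph0 !(mul0r, addr0).
move=> x y xy0; have [->|x0] := eqVneq x 0; first by left.
have [->|y0] := eqVneq y 0; first by right.
have [x' [m [Em m0]]] := conj x x0.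
have [y' [n [En n0]]] := conj y y0.
have : iota (m * n) = 0 by rewrite rmorphM -Em -En mulrACA xy0 mul0r.
by move/iota_inj/eqP; rewrite mulf_eq0 (negPf m0) (negPf n0).
Qed.

Lemma biquad_quotient_domain (E : comNzRingType)
    (pi : {rmorphism {poly {poly {poly F}}} -> E}) (c d : F) :
  c != 0 -> d != 0 -> c != d ->
  (forall p : {poly F}, pi p%:P%:P = 0 -> p = 0) -> (forall x, exists p, x = pi p) ->
  pi 'X%:P ^+ 2 = pi ('X^2 + c%:P)%:P%:P -> pi 'X ^+ 2 = pi ('X^2 + d%:P)%:P%:P ->
  forall x y : E, x * y = 0 -> x = 0 \/ y = 0.
Proof.
move=> c0 d0 cd pi_inj pi_surj Ec Ed.
pose iota : {rmorphism {poly F} -> E} := (pi \o polyC) \o polyC.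
have iE a : pi a%:P%:P = iota a by [].
apply: (@biquad_domain E iota _ _ _ _ c0 d0 cd pi_inj Ec Ed) => x.
have [p ->] := pi_surj x.
have [a0 [a1 [a2 [a3]]]] := biquad_rep Ec Ed p.
by rewrite !iE => Ep; exists a0, a1, a2, a3; exact: Ep.
Qed.

End NonSquareQuadratics.

(** * Domains of sums and composites of admissible pairs *)

Section AdmissiblePairs.
Variables (F : fieldType) (V : lmodType F) (br : V -> V -> V).

Definition subalgebra (S : V -> Prop) : Prop :=
  subspace_pred S /\ (forall x y, S x -> S y -> S (br x y)).

Definition admissible_pair (L : V -> Prop) (h : V -> V) (H : V -> Prop) : Prop :=
  (
     subalgebra H
     /\ (forall x, H x -> L x)
     /\ finite_codim L H
     /\ (forall x, H x -> L (h x))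
     /\ (forall x y, H x -> H y -> h (x + y) = h x + h y)
     /\ (forall c x, H x -> h (c *: x) = c *: h x)
     /\ (forall p1 p2, H p1 -> H p2 ->
         h (br p1 p2) = br (h p1) p2 /\ h (br p1 p2) = br p1 (h p2))).

Definition comp_dom (H1 H2 : V -> Prop) (h2 : V -> V) : V -> Prop :=
  fun w => [/\ H1 w, H2 w & H1 (h2 w)].

Lemma subalgebra_cap (H1 H2 : V -> Prop) :
  subalgebra H1 -> subalgebra H2 -> subalgebra (fun x => H1 x /\ H2 x).
Proof.
move=> [[z1 d1 s1] b1] [[z2 d2 s2] b2]; split; first split=> //.
- by move=> x y [x1 x2] [y1 y2]; split; [apply: d1 | apply: d2].
- by move=> c x [x1 x2]; split; [apply: s1 | apply: s2].
by move=> x y [x1 x2] [y1 y2]; split; [apply: b1 | apply: b2].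
Qed.

(** Stability under the bracket uses h2 [x, y] = [h2 x, y], a bracket of two elements of H1. *)
Lemma comp_dom_subalgebra (L H1 H2 : V -> Prop) (h2 : V -> V) :
  subalgebra H1 -> admissible_pair L h2 H2 -> subalgebra (comp_dom H1 H2 h2).
Proof.
move=> [[z1 d1 s1] b1] [[[z2 d2 s2] b2] [_ [_ [_ [hD [hZ hbr]]]]]].
have h0 : h2 0 = 0 by rewrite -(scale0r 0) hZ // !scale0r.
split; first split.
- split; rewrite ?h0 //.
- move=> x y [x1 x2 hx] [y1 y2 hy]; split; [exact: d1|exact: d2|].
  by rewrite hD //; apply: d1.
- move=> c x [x1 x2 hx]; split; [exact: s1|exact: s2|].
  by rewrite hZ //; apply: s1.
move=> x y [x1 x2 hx] [y1 y2 hy]; split; [exact: b1|exact: b2|].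
by rewrite (proj1 (hbr _ _ x2 y2)); apply: b1.
Qed.

Lemma admissible_pair_cap (L H1 H2 : V -> Prop) (h1 h2 : V -> V) :
  admissible_pair L h1 H1 -> admissible_pair L h2 H2 ->
  finite_codim L (fun x => H1 x /\ H2 x).
Proof.
move=> [[sub1 _] [H1L [cod1 _]]] [[sub2 _] [_ [cod2 _]]].
exact: finite_codim_cap.
Qed.

Lemma comp_dom_codim (L H1 H2 : V -> Prop) (h1 h2 : V -> V) :
  admissible_pair L h1 H1 -> admissible_pair L h2 H2 ->
  finite_codim L (comp_dom H1 H2 h2).
Proof.
move=> [[sub1 _] [H1L [cod1 _]]] [[sub2 _] [H2L [cod2 [hL [hD [hZ _]]]]]].
have codh := finite_codim_preim sub2 sub1 hD hZ hL cod1.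
have sub2h : subspace_pred (fun x => H2 x /\ H1 (h2 x)).
  have [z1 d1 s1] := sub1; have [z2 d2 s2] := sub2.
  have h0 : h2 0 = 0 by rewrite -(scale0r 0) hZ // !scale0r.
  split=> [|x y [x2 hx] [y2 hy]|c x [x2 hx]]; first by rewrite h0.
    by rewrite hD //; split; [apply: d2 | apply: d1].
  by rewrite hZ //; split; [apply: s2 | apply: s1].
have codLh := finite_codim_trans H2L cod2 codh.
have [n [w [Lw gen]]] := finite_codim_cap sub1 sub2h H1L cod1 codLh.
exists n, w; split=> // x /gen [cs [y [[y1 [y2 hy]] E]]].
by exists cs, y; split=> //; split.
Qed.

End AdmissiblePairs.

(* [zeta p] stands for p(z), with z = v_i^2 + r_i, and [vec], [co1], [co2], [co3] are the
   coordinates in the basis alpha_i of the tensor product of so_3 with E. *)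
Record so3_cover (F : numClosedFieldType) (E : comNzRingType) (V : lmodType F) :=
  So3Cover {
  zeta : {rmorphism {poly F} -> E};
  r1 : F; r2 : F; r3 : F; v1 : E; v2 : E; v3 : E;
  vec : E -> E -> E -> V; co1 : V -> E; co2 : V -> E; co3 : V -> E;
  br : V -> V -> V;
  zeta_inj : forall p, zeta p = 0 -> p = 0;
  domE : forall x y : E, x * y = 0 -> x = 0 \/ y = 0;
  r12 : r1 != r2; r13 : r1 != r3;
  v1_sqr : v1 ^+ 2 = zeta ('X - r1%:P);
  v2_sqr : v2 ^+ 2 = zeta ('X - r2%:P);
  v3_sqr : v3 ^+ 2 = zeta ('X - r3%:P);
  vec_eta : forall x, vec (co1 x) (co2 x) (co3 x) = x;
  co1_vec : forall a b c, co1 (vec a b c) = a;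
  co2_vec : forall a b c, co2 (vec a b c) = b;
  co3_vec : forall a b c, co3 (vec a b c) = c;
  co1D : forall x y, co1 (x + y) = co1 x + co1 y;
  co2D : forall x y, co2 (x + y) = co2 x + co2 y;
  co3D : forall x y, co3 (x + y) = co3 x + co3 y;
  co1Z : forall c x, co1 (c *: x) = zeta c%:P * co1 x;
  co2Z : forall c x, co2 (c *: x) = zeta c%:P * co2 x;
  co3Z : forall c x, co3 (c *: x) = zeta c%:P * co3 x;
  co1_br : forall x y, co1 (br x y) = co2 x * co3 y - co3 x * co2 y;
  co2_br : forall x y, co2 (br x y) = co3 x * co1 y - co1 x * co3 y;
  co3_br : forall x y, co3 (br x y) = co1 x * co2 y - co2 x * co1 y }.

(** * The E-module structure and the coordinate modules M_i *)

Section Cover.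
Variables (F : numClosedFieldType) (E : comNzRingType) (V : lmodType F).
Variable m : so3_cover E V.
Local Notation zeta := (zeta m).
Local Notation r1 := (r1 m).
Local Notation r2 := (r2 m).
Local Notation r3 := (r3 m).
Local Notation v1 := (v1 m).
Local Notation v2 := (v2 m).
Local Notation v3 := (v3 m).
Local Notation vec := (vec m).
Local Notation co1 := (co1 m).
Local Notation co2 := (co2 m).
Local Notation co3 := (co3 m).
Local Notation br := (br m).

(** The E-module structure of the tensor product, kept apart from the F-module structure of V in
    which codimension is measured. *)
Definition esc (a : E) (x : V) : V := vec (a * co1 x) (a * co2 x) (a * co3 x).

Lemma vec_ext (x y : V) : co1 x = co1 y -> co2 x = co2 y -> co3 x = co3 y -> x = y.
Proof. by move=> E1 E2 E3; rewrite -(vec_eta m x) E1 E2 E3 vec_eta. Qed.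

Definition coE := (co1_vec, co2_vec, co3_vec, co1D, co2D, co3D, co1Z, co2Z, co3Z,
  co1_br, co2_br, co3_br).

Lemma co1_esc a x : co1 (esc a x) = a * co1 x. Proof. exact: co1_vec. Qed.
Lemma co2_esc a x : co2 (esc a x) = a * co2 x. Proof. exact: co2_vec. Qed.
Lemma co3_esc a x : co3 (esc a x) = a * co3 x. Proof. exact: co3_vec. Qed.

Lemma co1_0 : co1 0 = 0. Proof. by rewrite -(scale0r 0) co1Z !rmorph0 mul0r. Qed.
Lemma co2_0 : co2 0 = 0. Proof. by rewrite -(scale0r 0) co2Z !rmorph0 mul0r. Qed.
Lemma co3_0 : co3 0 = 0. Proof. by rewrite -(scale0r 0) co3Z !rmorph0 mul0r. Qed.

Definition escE := (co1_esc, co2_esc, co3_esc, co1_0, co2_0, co3_0).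

Lemma mulE_neq0 (a b : E) : a != 0 -> b != 0 -> a * b != 0.
Proof.
move=> /eqP a0 /eqP b0; apply/eqP => /(domE m) [].
  exact: a0.
exact: b0.
Qed.

Lemma mulE_inj (a x y : E) : a != 0 -> a * x = a * y -> x = y.
Proof.
move=> a0 /eqP; rewrite -subr_eq0 -mulrBr => /eqP /(domE m) [/eqP|/eqP].
  by rewrite (negPf a0).
by rewrite subr_eq0 => /eqP.
Qed.

Lemma esc_inj a x y : a != 0 -> esc a x = esc a y -> x = y.
Proof.
move=> a0 Exy; apply: vec_ext; apply: (mulE_inj a0).
- by rewrite -!co1_esc Exy.
- by rewrite -!co2_esc Exy.
by rewrite -!co3_esc Exy.
Qed.

Lemma escD a x y : esc a (x + y) = esc a x + esc a y.
Proof. by apply: vec_ext; rewrite !(escE, coE) mulrDr. Qed.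
Lemma escZ a c x : esc a (c *: x) = c *: esc a x.
Proof. by apply: vec_ext; rewrite !(escE, coE) mulrCA. Qed.
Lemma esc0 a : esc a 0 = 0.
Proof. by apply: vec_ext; rewrite !escE mulr0. Qed.
Lemma escDl a b x : esc (a + b) x = esc a x + esc b x.
Proof. by apply: vec_ext; rewrite !(escE, coE) mulrDl. Qed.
Lemma escA a b x : esc a (esc b x) = esc (a * b) x.
Proof. by apply: vec_ext; rewrite !escE mulrA. Qed.
Lemma escCA a b x : esc a (esc b x) = esc b (esc a x).
Proof. by rewrite !escA mulrC. Qed.
Lemma esc_zetaC c x : esc (zeta c%:P) x = c *: x.
Proof. by apply: vec_ext; rewrite !(escE, coE). Qed.
Lemma esc_brl a x y : br (esc a x) y = esc a (br x y).
Proof. by apply: vec_ext; rewrite !(escE, coE) mulrBr !mulrA. Qed.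
Lemma esc_brr a x y : br x (esc a y) = esc a (br x y).
Proof. by apply: vec_ext; rewrite !(escE, coE) mulrBr; congr (_ - _); rewrite mulrCA. Qed.

(** For (a, b) = (v_i, v_j v_k) this is the module M_i; for (1, y) it is the ring A. *)
Definition inM (a b x : E) : Prop := exists p q, x = a * zeta p + b * zeta q.

(* Membership in C[z, y]. *)
Definition inA (x : E) : Prop := inM 1 (v1 * v2 * v3) x.

Lemma inM0 a b : inM a b 0.
Proof. by exists 0, 0; rewrite !rmorph0 !mulr0 addr0. Qed.

Lemma inMD a b x y : inM a b x -> inM a b y -> inM a b (x + y).
Proof.
move=> [p [q ->]] [p' [q' ->]]; exists (p + p'), (q + q').
by rewrite !rmorphD /= !mulrDr addrACA.
Qed.

Lemma inMZ a b r x : inM a b x -> inM a b (zeta r * x).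
Proof.
move=> [p [q ->]]; exists (r * p), (r * q).
by rewrite !rmorphM /= mulrDr !(mulrCA _ (zeta r)).
Qed.

Lemma inMN a b x : inM a b x -> inM a b (- x).
Proof. by move/(inMZ (-1)); rewrite rmorphN rmorph1 mulN1r. Qed.

Lemma inMB a b x y : inM a b x -> inM a b y -> inM a b (x - y).
Proof. by move=> xM yM; apply: inMD => //; apply: inMN. Qed.

Lemma inMl a b p : inM a b (a * zeta p).
Proof. by exists p, 0; rewrite rmorph0 mulr0 addr0. Qed.

Lemma inMr a b p : inM a b (b * zeta p).
Proof. by exists 0, p; rewrite rmorph0 mulr0 add0r. Qed.

(* The three coordinate modules multiply cyclically: M_b M_c is contained in M_a. *)
Lemma inM_mul a b c fa fb fc x y :
  a ^+ 2 = zeta fa -> b ^+ 2 = zeta fb -> c ^+ 2 = zeta fc ->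
  inM b (c * a) x -> inM c (a * b) y -> inM a (b * c) (x * y).
Proof.
move=> Ea Eb Ec [p [q ->]] [p' [q' ->]].
exists (fb * p * q' + fc * q * p'), (p * p' + fa * q * q').
rewrite !(rmorphD zeta) !(rmorphM zeta) -Ea -Eb -Ec.
by move: (zeta p) (zeta p') (zeta q) (zeta q') => P P' Q Q'; ring.
Qed.

(** Stated for a generic triple, so that its three cyclic rotations serve the three coordinates. *)
Lemma inM_act a b c fa fb fc x y :
  a ^+ 2 = zeta fa -> b ^+ 2 = zeta fb -> c ^+ 2 = zeta fc ->
  inM 1 (a * b * c) x -> inM a (b * c) y -> inM a (b * c) (x * y).
Proof.
move=> Ea Eb Ec [p [q ->]] [p' [q' ->]].
exists (p * p' + fb * fc * q * q'), (p * q' + fa * q * p').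
rewrite !(rmorphD zeta) !(rmorphM zeta) -Ea -Eb -Ec.
by move: (zeta p) (zeta p') (zeta q) (zeta q') => P P' Q Q'; ring.
Qed.

Lemma inAM x y : inA x -> inA y -> inA (x * y).
Proof.
move=> [p [q ->]] [p' [q' ->]].
exists (p * p' + ('X - r1%:P) * ('X - r2%:P) * ('X - r3%:P) * q * q'), (p * q' + q * p').
rewrite !(rmorphD zeta) !(rmorphM zeta) -v1_sqr -v2_sqr -v3_sqr.
move: (zeta p) (zeta p') (zeta q) (zeta q') => P P' Q Q'.
by move: v1 v2 v3 => a b c; ring.
Qed.

Lemma inA_v1 x : inM v1 (v2 * v3) x -> inA (x * v1).
Proof.
move=> [p [q ->]]; exists (('X - r1%:P) * p), q.
rewrite (rmorphM zeta) -v1_sqr.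
by move: (zeta p) (zeta q) v1 v2 v3 => P Q x1 x2 x3; ring.
Qed.

Lemma inA_zeta p : inA (zeta p). Proof. by rewrite -[zeta p]mul1r; apply: inMl. Qed.
Lemma inA_y : inA (v1 * v2 * v3).
Proof. by rewrite -[X in inA X]mulr1 -(rmorph1 zeta); apply: inMr. Qed.
Lemma inA1 : inA 1. Proof. by rewrite -(rmorph1 zeta); apply: inA_zeta. Qed.

Lemma v1_neq0 : v1 != 0.
Proof.
apply/eqP => v10; have := v1_sqr m; rewrite v10 expr0n /= => /esym/zeta_inj/eqP.
by rewrite polyXsubC_eq0.
Qed.

Lemma v2_neq0 : v2 != 0.
Proof.
apply/eqP => v20; have := v2_sqr m; rewrite v20 expr0n /= => /esym/zeta_inj/eqP.
by rewrite polyXsubC_eq0.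
Qed.

Lemma inA_norm b : inA b -> b != 0 -> exists b' N, [/\ inA b', N != 0 & b * b' = zeta N].
Proof.
move=> [p [q ->]] b0; set f := ('X - r1%:P) * ('X - r2%:P) * ('X - r3%:P).
(* The conjugate of b under y -> -y, and the norm p^2 - f q^2, which is nonzero because the cubic f
   is not a square. *)
exists (1 * zeta p - (v1 * v2 * v3) * zeta q), (p ^+ 2 - f * q ^+ 2); split.
- by apply: inMB; [apply: inMl | apply: inMr].
- apply: contra_neq b0 => /eqP; rewrite subr_eq0 => /eqP.
  case/(nonsquare_cubic (r12 m) (r13 m)) => -> ->.
  by rewrite !rmorph0 !mulr0 addr0.
rewrite rmorphB /f !(rmorphM zeta) -v1_sqr -v2_sqr -v3_sqr.
by move: (zeta p) (zeta q) v1 v2 v3 => P Q x1 x2 x3; ring.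
Qed.

(** * The algebra R generated by the elements alpha_i (x) v_i *)

Definition gen_subalgebra (x : V) : Prop :=
  forall S, subalgebra br S -> S (vec v1 0 0) -> S (vec 0 v2 0) -> S (vec 0 0 v3) -> S x.

Local Notation G := gen_subalgebra.

Lemma gen_subalgebraP : subalgebra br G.
Proof.
split; first split=> [S [[]] // | x y xR yR S subS g1 g2 g3 | c x xR S subS g1 g2 g3].
- by have [[_ SD _] _] := subS; apply: SD; [apply: xR | apply: yR].
- by have [[_ _ SZ] _] := subS; apply: SZ; apply: xR.
move=> x y xR yR S subS g1 g2 g3.
by have [_ Sbr] := subS; apply: Sbr; [apply: xR | apply: yR].
Qed.

Lemma gen_subalgebra_coord x : G x ->
  [/\ inM v1 (v2 * v3) (co1 x), inM v2 (v3 * v1) (co2 x) & inM v3 (v1 * v2) (co3 x)].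
Proof.
have H1 := v1_sqr m; have H2 := v2_sqr m; have H3 := v3_sqr m.
have M1 (a b : E) : inM a b a by rewrite -[X in inM _ _ X]mulr1 -(rmorph1 zeta); apply: inMl.
move/(_ (fun x => [/\ inM v1 (v2 * v3) (co1 x), inM v2 (v3 * v1) (co2 x)
  & inM v3 (v1 * v2) (co3 x)])); apply; last 3 first.
- by rewrite !coE; split; [apply: M1 | apply: inM0 | apply: inM0].
- by rewrite !coE; split; [apply: inM0 | apply: M1 | apply: inM0].
- by rewrite !coE; split; [apply: inM0 | apply: inM0 | apply: M1].
split; first split.
- by rewrite !escE; split; apply: inM0.
- by move=> y z [y1 y2 y3] [z1 z2 z3]; rewrite !coE; split; apply: inMD.
- by move=> c y [y1 y2 y3]; rewrite !coE; split; apply: inMZ.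
move=> y z [y1 y2 y3] [z1 z2 z3]; rewrite !coE; split; apply: inMB.
- exact: (inM_mul H1 H2 H3).
- by rewrite [X in inM _ _ X]mulrC; apply: (inM_mul H1 H2 H3).
- exact: (inM_mul H2 H3 H1).
- by rewrite [X in inM _ _ X]mulrC; apply: (inM_mul H2 H3 H1).
- exact: (inM_mul H3 H1 H2).
- by rewrite [X in inM _ _ X]mulrC; apply: (inM_mul H3 H1 H2).
Qed.

(* Bracketing twice with B b multiplies A (a p) by b^2, which is z - r. *)
Lemma bracket_chain (A B C : E -> V) (a b : E) (r : F) (S : V -> Prop) :
  (forall x y, A (x + y) = A x + A y) -> (forall c x, A (zeta c%:P * x) = c *: A x) ->
  (forall x y, br (A x) (B y) = C (x * y)) -> (forall x y, br (B x) (C y) = A (x * y)) ->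
  (forall x y, C (x + y) = C x + C y) -> (forall c x, C (zeta c%:P * x) = c *: C x) ->
  b ^+ 2 = zeta ('X - r%:P) -> subalgebra br S -> S (A a) -> S (B b) ->
  forall p, S (A (a * zeta p)) /\ S (C (a * b * zeta p)).
Proof.
move=> AD AZ AB BC CD CZ Eb [[S0 SD SZ] Sbr] SA SB.
have toC x : S (A (a * x)) -> S (C (a * b * x)).
  by move=> Sx; have := Sbr _ _ Sx SB; rewrite AB mulrAC.
suff H p : S (A (a * zeta p)) by move=> p; split; last exact: toC.
have A0 : A 0 = 0 by rewrite -(mulr0 (zeta 0%:P)) AZ scale0r.
elim/poly_ind: p => [|p c IHp]; first by rewrite rmorph0 mulr0 A0.
have -> : a * zeta (p * 'X + c%:P) =
    b * (a * b * zeta p) + (zeta r%:P * (a * zeta p) + zeta c%:P * a).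
  have -> : zeta (p * 'X + c%:P) = zeta p * (b ^+ 2 + zeta r%:P) + zeta c%:P.
    by rewrite Eb -(rmorphD zeta) subrK (rmorphD zeta) (rmorphM zeta).
  by move: (zeta p) (zeta r%:P) (zeta c%:P) => P R C'; ring.
rewrite !AD !AZ -BC; apply: (SD); first by apply: Sbr => //; apply: toC.
by apply: (SD); apply: SZ.
Qed.

Definition in1 (a : E) : V := vec a 0 0.
Definition in2 (a : E) : V := vec 0 a 0.
Definition in3 (a : E) : V := vec 0 0 a.

Lemma in1D a b : in1 (a + b) = in1 a + in1 b.
Proof. by apply: vec_ext; rewrite !coE ?addr0. Qed.
Lemma in2D a b : in2 (a + b) = in2 a + in2 b.
Proof. by apply: vec_ext; rewrite !coE ?addr0. Qed.
Lemma in3D a b : in3 (a + b) = in3 a + in3 b.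
Proof. by apply: vec_ext; rewrite !coE ?addr0. Qed.
Lemma in1Z c a : in1 (zeta c%:P * a) = c *: in1 a.
Proof. by apply: vec_ext; rewrite !coE ?mulr0. Qed.
Lemma in2Z c a : in2 (zeta c%:P * a) = c *: in2 a.
Proof. by apply: vec_ext; rewrite !coE ?mulr0. Qed.
Lemma in3Z c a : in3 (zeta c%:P * a) = c *: in3 a.
Proof. by apply: vec_ext; rewrite !coE ?mulr0. Qed.

Lemma br12 a b : br (in1 a) (in2 b) = in3 (a * b).
Proof. by apply: vec_ext; rewrite !coE ?(mulr0, mul0r, subr0). Qed.
Lemma br23 a b : br (in2 a) (in3 b) = in1 (a * b).
Proof. by apply: vec_ext; rewrite !coE ?(mulr0, mul0r, subr0). Qed.
Lemma br31 a b : br (in3 a) (in1 b) = in2 (a * b).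
Proof. by apply: vec_ext; rewrite !coE ?(mulr0, mul0r, subr0). Qed.

Definition basis (i : 'I_6) : V :=
  [:: in1 v1; in1 (v2 * v3); in2 v2; in2 (v3 * v1); in3 v3; in3 (v1 * v2)]`_i.

Lemma esc_in1 a b : esc a (in1 b) = in1 (b * a).
Proof. by apply: vec_ext; rewrite !(escE, coE) ?mulr0 // mulrC. Qed.
Lemma esc_in2 a b : esc a (in2 b) = in2 (b * a).
Proof. by apply: vec_ext; rewrite !(escE, coE) ?mulr0 // mulrC. Qed.
Lemma esc_in3 a b : esc a (in3 b) = in3 (b * a).
Proof. by apply: vec_ext; rewrite !(escE, coE) ?mulr0 // mulrC. Qed.

(** Each cyclic rotation of [bracket_chain] fills two of the six lines: that of v_i in coordinate i,
    and that of v_i v_j in the remaining coordinate k. *)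
Lemma gen_subalgebra_basis (i : 'I_6) p : G (esc (zeta p) (basis i)).
Proof.
have S1 : G (in1 v1) by move=> S _.
have S2 : G (in2 v2) by move=> S _.
have S3 : G (in3 v3) by move=> S _.
have c1 := bracket_chain in1D in1Z br12 br23 in3D in3Z (v2_sqr m) gen_subalgebraP S1 S2 p.
have c2 := bracket_chain in2D in2Z br23 br31 in1D in1Z (v3_sqr m) gen_subalgebraP S2 S3 p.
have c3 := bracket_chain in3D in3Z br31 br12 in2D in2Z (v1_sqr m) gen_subalgebraP S3 S1 p.
case: c1 c2 c3 => [a1 b1] [a2 b2] [a3 b3].
by case: i => [[|[|[|[|[|[|k]]]]]] Hk] //; rewrite /basis /= ?(esc_in1, esc_in2, esc_in3).
Qed.

Lemma gen_subalgebra_span x : G x <-> exists P : 'I_6 -> {poly F},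
  x = \sum_(i < 6) esc (zeta (P i)) (basis i).
Proof.
split=> [/gen_subalgebra_coord [[p1 [q1 E1]] [p2 [q2 E2]] [p3 [q3 E3]]]|[P ->]].
  exists (fun i => [:: p1; q1; p2; q2; p3; q3]`_i).
  rewrite !big_ord_recl big_ord0 /basis /= !(esc_in1, esc_in2, esc_in3).
  by apply: vec_ext; rewrite !(escE, coE) ?E1 ?E2 ?E3 !(add0r, addr0).
have [[R0 RD _] _] := gen_subalgebraP.
by apply: big_ind => // i _; apply: gen_subalgebra_basis.
Qed.

Lemma gen_subalgebra_vec x :
  inM v1 (v2 * v3) (co1 x) -> inM v2 (v3 * v1) (co2 x) -> inM v3 (v1 * v2) (co3 x) -> G x.
Proof.
move=> [p1 [q1 E1]] [p2 [q2 E2]] [p3 [q3 E3]]; apply/gen_subalgebra_span.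
exists (fun i => [:: p1; q1; p2; q2; p3; q3]`_i).
rewrite !big_ord_recl big_ord0 /basis /= !(esc_in1, esc_in2, esc_in3).
by apply: vec_ext; rewrite !(escE, coE) ?E1 ?E2 ?E3 !(add0r, addr0).
Qed.

Lemma gen_subalgebra_esc a x : inA a -> G x -> G (esc a x).
Proof.
have H1 := v1_sqr m; have H2 := v2_sqr m; have H3 := v3_sqr m.
move=> aA /gen_subalgebra_coord [x1 x2 x3]; apply: gen_subalgebra_vec; rewrite !escE.
- exact: (inM_act H1 H2 H3).
- by apply: (inM_act H2 H3 H1) => //; rewrite mulrC mulrA.
by apply: (inM_act H3 H1 H2) => //; rewrite -mulrA mulrC.
Qed.

Lemma esc_zeta_coef n (q : {poly F}) x : (size q <= n)%N ->
  esc (zeta q) x = \sum_(k < n) q`_k *: esc (zeta 'X^k) x.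
Proof.
move=> szq; have Eq : q = \sum_(k < n) q`_k *: 'X^k.
  rewrite -poly_def; apply/polyP => k; rewrite coef_poly.
  by case: ltnP => // nk; rewrite nth_default // (leq_trans szq).
rewrite {1}Eq (big_morph zeta (rmorphD zeta) (rmorph0 zeta)).
rewrite (big_morph (fun a => esc a x) (fun a b => escDl a b x) (id1 := 0)).
  by apply: eq_bigr => k _; rewrite -mul_polyC (rmorphM zeta) -escA esc_zetaC.
by apply: vec_ext; rewrite !escE mul0r.
Qed.

(** Divide the six polynomial coefficients of an element of G by the norm N. The remainders are
    covered by finitely many vectors z^k [basis i], and the quotients contribute an element of N G =
    b (b' G), which lies in b G. *)
Lemma gen_subalgebra_esc_codim b : inA b -> b != 0 ->
  finite_codim G (fun y => exists2 x, G x & y = esc b x).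
Proof.
move=> bA b0; have [b' [N [b'A N0 bb']]] := inA_norm bA b0.
apply: (@finite_codim_fin _ _ ('I_6 * 'I_(size N))%type
  (fun k => esc (zeta 'X^(k.2)) (basis k.1))) => [k|x /gen_subalgebra_span [P ->]].
  exact: gen_subalgebra_basis.
exists (fun k : 'I_6 * 'I_(size N) => (P k.1 %% N)`_(k.2 : nat)).
exists (esc b (esc b' (\sum_(i < 6) esc (zeta (P i %/ N)) (basis i)))); split.
  by eexists; last reflexivity; apply: gen_subalgebra_esc => //; apply/gen_subalgebra_span; eexists.
rewrite escA bb' (big_morph _ (escD _) (esc0 _)) -(pair_bigA _ (fun i (k : 'I_(size N)) =>
  (P i %% N)`_k *: esc (zeta 'X^k) (basis i))) -big_split /=.
apply: eq_bigr => i _; rewrite {1}(divp_eq (P i) N) rmorphD escDl addrC; congr (_ + _).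
  by rewrite rmorphM /= mulrC -escA.
by rewrite -esc_zeta_coef // ltnW // ltn_modpN0.
Qed.

(* H meets every line in1 (a zeta(-)): the vectors in1 (a z^k) are
   dependent modulo H. *)
Lemma codim_meets (H : V -> Prop) (A : E -> V) (a : E) :
  (forall x y, A (x + y) = A x + A y) -> (forall c x, A (zeta c%:P * x) = c *: A x) ->
  subspace_pred H -> finite_codim G H -> (forall p, G (A (a * zeta p))) ->
  exists2 p, p != 0 & H (A (a * zeta p)).
Proof.
move=> AD AZ subH cod RA; have [n dep] := finite_codim_dependent subH cod.
have [c [c0 Hc]] := dep (fun k => A (a * zeta 'X^k)) (fun=> RA _).
exists (\sum_(k < n.+1) c 0 k *: 'X^k).
  apply: contra_neq c0 => p0; apply/rowP => i; rewrite mxE.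
  move/(congr1 (fun p : {poly F} => p`_i)): p0; rewrite coef0 coef_sum (bigD1 i) //=.
  rewrite coefZ coefXn eqxx mulr1 big1 ?addr0 // => j ji.
  by rewrite coefZ coefXn eq_sym (inj_eq val_inj) (negPf ji) mulr0.
have A0 : A 0 = 0 by rewrite -(mulr0 (zeta 0%:P)) AZ scale0r.
rewrite (big_morph zeta (rmorphD zeta) (rmorph0 zeta)) mulr_sumr (big_morph A AD A0).
move: Hc; congr H; apply: eq_bigr => i _.
by rewrite -AZ mulrCA -(rmorphM zeta) -mul_polyC.
Qed.

(** * Fractions of A = C[z, y] *)

(** A concrete form of Q. Fractions are pairs over E whose terms need not lie in A, so membership is
    stated up to equality of fractions. *)
Definition in_function_field (f : E * E) : Prop :=
  f.2 != 0 /\ exists a b, [/\ inA a, inA b, b != 0 & f.1 * b = a * f.2].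

Local Notation Q := in_function_field.

Lemma inA_fraction a b : inA a -> inA b -> b != 0 -> Q (a, b).
Proof. by move=> aA bA b0; split=> //; exists a, b. Qed.

Lemma function_field_eq (f g : E * E) : Q f -> g.2 != 0 -> f.1 * g.2 = g.1 * f.2 -> Q g.
Proof.
move=> [f0 [a [b [aA bA b0 Ef]]]] g0 Efg; split=> //; exists a, b; split=> //.
apply: (mulE_inj f0).
by rewrite mulrA [f.2 * _]mulrC -Efg mulrAC Ef mulrAC mulrC.
Qed.

Lemma function_field_add (f g : E * E) :
  Q f -> Q g -> Q (f.1 * g.2 + g.1 * f.2, f.2 * g.2).
Proof.
move=> [f0 [a [b [aA bA b0 Ef]]]] [g0 [c [d [cA dA d0 Eg]]]]; split=> /=.
  exact: mulE_neq0.
exists (a * d + c * b), (b * d); split; [|exact: inAM|exact: mulE_neq0|].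
  by apply: inMD; apply: inAM.
have -> : (a * d + c * b) * (f.2 * g.2) =
  (a * f.2) * (d * g.2) + (c * g.2) * (b * f.2) by ring.
by rewrite -Ef -Eg; ring.
Qed.

Lemma function_field_opp (f : E * E) : Q f -> Q (- f.1, f.2).
Proof.
move=> [f0 [a [b [aA bA b0 Ef]]]]; split=> //; exists (- a), b; split=> //.
  exact: inMN.
by rewrite /= !mulNr Ef.
Qed.

Lemma function_field_mul (f g : E * E) : Q f -> Q g -> Q (f.1 * g.1, f.2 * g.2).
Proof.
move=> [f0 [a [b [aA bA b0 Ef]]]] [g0 [c [d [cA dA d0 Eg]]]]; split=> /=.
  exact: mulE_neq0.
exists (a * c), (b * d); split; [exact: inAM|exact: inAM|exact: mulE_neq0|].
by rewrite mulrACA Ef Eg mulrACA.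
Qed.

Lemma function_field_inv (f : E * E) : Q f -> f.1 != 0 -> Q (f.2, f.1).
Proof.
move=> [f0 [a [b [aA bA b0 Ef]]]] f10; split=> //; exists b, a; split=> //.
  apply/eqP => a0; have := mulE_neq0 f10 b0; rewrite Ef a0 mul0r eqxx; done.
by rewrite mulrC -Ef mulrC.
Qed.

Lemma function_field_generated (S : E * E -> Prop) :
  (forall f g, S f -> g.2 != 0 -> f.1 * g.2 = g.1 * f.2 -> S g) ->
  (forall c, S (zeta c%:P, 1)) ->
  (forall f g, S f -> S g -> S (f.1 * g.2 + g.1 * f.2, f.2 * g.2)) ->
  (forall f g, S f -> S g -> S (f.1 * g.1, f.2 * g.2)) ->
  (forall f, S f -> f.1 != 0 -> S (f.2, f.1)) ->
  S (zeta 'X, 1) -> S (v1 * v2 * v3, 1) -> forall f, Q f -> S f.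
Proof.
move=> Seq Sc SD SM SV Sz Sy.
have SD1 a b : S (a, 1) -> S (b, 1) -> S (a + b, 1).
  by move=> Sa Sb; have := SD _ _ Sa Sb; rewrite /= !mulr1.
have SM1 a b : S (a, 1) -> S (b, 1) -> S (a * b, 1).
  by move=> Sa Sb; have := SM _ _ Sa Sb; rewrite /= !mulr1.
have Szeta p : S (zeta p, 1).
  elim/poly_ind: p => [|p c IHp]; first by rewrite rmorph0 -(rmorph0 zeta) -polyC0.
  by rewrite (rmorphD zeta) (rmorphM zeta); apply: (SD1) => //; apply: SM1.
have SA a : inA a -> S (a, 1).
  by move=> [p [q ->]]; rewrite mul1r; apply: (SD1) => //; apply: SM1.
move=> [f1 f2] [f0 [a [b [/SA Sa /SA Sb b0 Ef]]]].
apply: (Seq _ _ (SM _ _ Sa (SV _ Sb b0))) => //=.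
by rewrite mulr1 mul1r Ef.
Qed.

(** * Admissible pairs as multiplications by fractions *)

Section FiniteCodimSubalgebra.
Variable L : V -> Prop.
Hypotheses (subL : subalgebra br L) (LR : forall x, L x -> G x).
Hypothesis codL : finite_codim G L.

Lemma codim_meets1 (H : V -> Prop) :
  subspace_pred H -> finite_codim L H ->
  exists x, [/\ inM v1 (v2 * v3) x, x != 0 & H (in1 x)].
Proof.
move=> subH codH.
have R1 p : G (in1 (v1 * zeta p)) by rewrite -esc_in1; apply: (gen_subalgebra_basis ord0).
have codRH := finite_codim_trans LR codL codH.
have [p p0 Hp] := codim_meets in1D in1Z subH codRH R1.
exists (v1 * zeta p); split=> //; first exact: inMl.
by apply: mulE_neq0; [exact: v1_neq0 | apply: contra_neq p0 => /zeta_inj].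
Qed.

Lemma codim_meets2 (H : V -> Prop) :
  subspace_pred H -> finite_codim L H -> exists2 x, x != 0 & H (in2 x).
Proof.
move=> subH codH.
have R2 p : G (in2 (v2 * zeta p)) by rewrite -esc_in2; apply: (gen_subalgebra_basis (@Ordinal 6 2 isT)).
have codRH := finite_codim_trans LR codL codH.
have [p p0 Hp] := codim_meets in2D in2Z subH codRH R2.
exists (v2 * zeta p) => //.
by apply: mulE_neq0; [exact: v2_neq0 | apply: contra_neq p0 => /zeta_inj].
Qed.

(* h is multiplication by r / s on H. *)
Definition multiplier (r s : E) (h : V -> V) (H : V -> Prop) : Prop :=
  forall x, H x -> esc s (h x) = esc r x.

(** E being a domain, one nonzero vector of K is enough to compare the two fractions; finite
    codimension supplies one on the first axis. *)
Lemma multiplier_unique (h : V -> V) (K : V -> Prop) r s r' s' :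
  finite_codim L K -> subspace_pred K ->
  multiplier r s h K -> multiplier r' s' h K -> r * s' = r' * s.
Proof.
move=> codK subK M M'; have [x [_ x0 Kx]] := codim_meets1 subK codK.
apply: (mulE_inj x0); rewrite ![x * _]mulrC.
have {}E1 : esc (r * s') (in1 x) = esc (r' * s) (in1 x).
  by rewrite [r * s']mulrC -(escA s' r) -M // escCA M' // escA mulrC.
by have := congr1 co1 E1; rewrite !(escE, coE).
Qed.

Lemma multiplier_eq (h h' : V -> V) (K : V -> Prop) r s r' s' :
  s != 0 -> s' != 0 -> r * s' = r' * s ->
  multiplier r s h K -> multiplier r' s' h' K -> forall x, K x -> h x = h' x.
Proof.
move=> s0 s'0 Er M M' x Kx; apply: (esc_inj (mulE_neq0 s0 s'0)).
by rewrite -!escA [LHS]escCA M // M' // !escA [s' * r]mulrC Er [r' * s]mulrC.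
Qed.

Lemma multiplier_sum (h h' : V -> V) (K : V -> Prop) r s r' s' :
  multiplier r s h K -> multiplier r' s' h' K ->
  multiplier (r * s' + r' * s) (s * s') (fun x => h x + h' x) K.
Proof.
move=> M M' x Kx; rewrite escD escDl -!escA [X in X + _]escCA M // M' //.
by rewrite ![in LHS]escA ![in RHS]escA [s' * r]mulrC [s * r']mulrC.
Qed.

Lemma multiplier_comp (h h' : V -> V) (H K : V -> Prop) r s r' s' :
  (forall x, K x -> H (h' x)) ->
  multiplier r s h H -> multiplier r' s' h' K ->
  multiplier (r * r') (s * s') (fun x => h (h' x)) K.
Proof.
move=> KH M M' x Kx.
by rewrite [s * s']mulrC -(escA s' s) M; [rewrite escCA M' // escA | apply: KH].
Qed.

(* Testing h([p1, p2]) on p1 = alpha_1 x, and p2 = alpha_1 x, alpha_2 y or p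
   shows that h is multiplication by the ratio of h (alpha_1 x) to alpha_1 x. *)
Lemma admissible_multiplier (h : V -> V) (H : V -> Prop) :
  admissible_pair br L h H ->
  exists r s, [/\ inA r, inA s, s != 0 & multiplier r s h H].
Proof.
move=> [[subH _] [HL [codH [hL [_ [_ hbr]]]]]].
have [x [xM x0 Hx]] := codim_meets1 subH codH.
have [y y0 Hy] := codim_meets2 subH codH.
have two0 : 2%:R != 0 :> E.
  rewrite -(rmorph_nat zeta); apply/eqP => /zeta_inj/eqP.
  by rewrite -polyC_natr polyC_eq0 pnatr_eq0.
have comm p q : H p -> H q -> br (h p) q = br p (h q).
  by move=> Hp Hq; have [<- <-] := hbr _ _ Hp Hq.
have double0 (z : E) : z = - z -> z = 0.
  move=> Ez; apply: (mulE_inj two0); rewrite mulr0 mulr_natl mulr2n.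
  by rewrite {2}Ez subrr.
(* At p = q the two sides of [comm] are opposite, so both vanish in characteristic 0. This confines
   [h (in1 x)] to the first axis and, below, [h (in2 y)] to the second. *)
have hx2 : co2 (h (in1 x)) = 0.
  apply: (mulE_inj x0); rewrite mulr0; apply: double0.
  have := congr1 co3 (comm _ _ Hx Hx).
  by rewrite !coE !(mulr0, mul0r, subr0, sub0r) => E0; rewrite -{1}E0 mulrC.
have hx3 : co3 (h (in1 x)) = 0.
  apply: (mulE_inj x0); rewrite mulr0; apply: double0.
  have := congr1 co2 (comm _ _ Hx Hx).
  by rewrite !coE !(mulr0, mul0r, subr0, sub0r) mulrC.
have hy1 : co1 (h (in2 y)) = 0.
  apply: (mulE_inj y0); rewrite mulr0; apply: double0.
  have := congr1 co3 (comm _ _ Hy Hy).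
  by rewrite !coE !(mulr0, mul0r, subr0, sub0r) mulrC.
have hy3 : co3 (h (in2 y)) = 0.
  apply: (mulE_inj y0); rewrite mulr0; apply: double0.
  have := congr1 co1 (comm _ _ Hy Hy).
  by rewrite !coE !(mulr0, mul0r, subr0, sub0r) => E0; rewrite -{1}E0 mulrC.
set a := co1 (h (in1 x)); set b := co2 (h (in2 y)).
(* Both test vectors are scaled by the same ratio, a/x = b/y. *)
have Eab : a * y = x * b.
  have := congr1 co3 (comm _ _ Hx Hy).
  by rewrite !coE !(mulr0, mul0r, subr0, sub0r).
have [aM _ _] := gen_subalgebra_coord (LR (hL _ Hx)).
(* The terms a and x lie in M_1 rather than in A; since v_1 M_1 is contained in A, multiplying both
   by v_1 yields a fraction of A. *)
exists (a * v1), (x * v1); split; [exact: inA_v1 | exact: inA_v1 | |].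
  by apply: mulE_neq0 => //; apply: v1_neq0.
suff M : multiplier a x h H.
  by move=> p Hp; rewrite ![_ * v1]mulrC -!escA M.
(* Bracketing with alpha_1 x determines the second and third coordinates of [h p]. The first is
   invisible to it and is read off from alpha_2 y, where [Eab] turns b/y into a/x. *)
move=> p Hp; have C1 := comm _ _ Hx Hp; have C2 := comm _ _ Hy Hp.
apply: vec_ext; rewrite !escE.
- apply: (mulE_inj y0).
  have := congr1 co3 C2; rewrite !coE hy1 !(mulr0, mul0r, subr0, sub0r) => /oppr_inj E1.
  by rewrite mulrCA -E1 !mulrA -Eab [y * a]mulrC.
- by have := congr1 co3 C1; rewrite !coE hx2 !(mulr0, mul0r, subr0, sub0r) => ->.
by have := congr1 co2 C1; rewrite !coE hx3 !(mulr0, mul0r, subr0, sub0r) => /oppr_inj ->.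
Qed.

Lemma multiplier_exists a b : inA a -> inA b -> b != 0 ->
  exists h H, admissible_pair br L h H /\ multiplier a b h H.
Proof.
move=> aA bA b0.
have [[L0 LD LZ] Lbr] := subL.
pose B x := exists2 y, L y & x = esc b y.
have subB : subspace_pred B.
  split=> [|x y [x' Lx ->] [y' Ly ->]|c x [x' Lx ->]]; first by exists 0; rewrite ?esc0.
    by exists (x' + y'); rewrite ?escD //; apply: LD.
  by exists (c *: x'); rewrite ?escZ //; apply: LZ.
(* Codimension is measured in G because a L lies in G but need not lie in L. It is bounded along G,
   b G, b L: the norm handles the first inclusion, and the second is the image under b of L inside
   G. *)
have codB : finite_codim G B.
  apply: (finite_codim_trans _ (gen_subalgebra_esc_codim bA b0)).
    by move=> _ [x Rx ->]; apply: gen_subalgebra_esc.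
  exact: (finite_codim_image (escD b) (escZ b) codL).
pose H x := L x /\ B (esc a x).
have codH : finite_codim L H.
  apply: (finite_codim_preim (proj1 subL) subB _ _ _ codB) => *.
  - exact: escD.
  - exact: escZ.
  by apply: gen_subalgebra_esc => //; apply: LR.
(* Division of a x by b is chosen pointwise on H, with value 0 elsewhere. Since multiplication by b
   is injective, each identity for h follows from its multiple by b. *)
have [h hP] : exists h, forall x, H x -> L (h x) /\ esc b (h x) = esc a x.
  have /choice [h hP] : forall x, exists y, H x -> L y /\ esc b y = esc a x.
    move=> x; have [[Lx [y Ly E1]]|nH] := EM (H x); first by exists y.
    by exists 0.
  by exists h.
have [B0 BD BZ] := subB.
have subH : subalgebra br H.
  split; first split=> [|x y [Lx Bx] [Ly By]|c x [Lx Bx]].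
  - by split=> //; rewrite esc0.
  - by split; [apply: LD | rewrite escD; apply: BD].
  - by split; [apply: LZ | rewrite escZ; apply: BZ].
  (* From a x = b x' follows a [x, y] = b [x', y], with x' and y in L. *)
  move=> x y [Lx [x' Lx' E1]] [Ly _]; split; first exact: Lbr.
  by exists (br x' y); [apply: Lbr | rewrite -!esc_brl E1].
have [[_ HD HZ] Hbr] := subH.
exists h, H; split; last by move=> x /hP [].
split=> //; split; first by move=> x [].
split=> //; split; first by move=> x /hP [].
split.
  move=> x y Hx Hy; apply: (esc_inj b0).
  by rewrite (proj2 (hP _ (HD _ _ Hx Hy))) !escD (proj2 (hP _ Hx)) (proj2 (hP _ Hy)).
split.
  move=> c x Hx; apply: (esc_inj b0).
  by rewrite (proj2 (hP _ (HZ c _ Hx))) !escZ (proj2 (hP _ Hx)).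
move=> x y Hx Hy; split; apply: (esc_inj b0); rewrite (proj2 (hP _ (Hbr _ _ Hx Hy))).
  by rewrite -!esc_brl (proj2 (hP _ Hx)).
by rewrite -!esc_brr (proj2 (hP _ Hy)).
Qed.

Definition multiplier_in_Q (h : V -> V) (H : V -> Prop) (f : E * E) : Prop :=
  Q f /\ multiplier f.1 f.2 h H.

Definition pair_equiv (h : V -> V) (H : V -> Prop) (h' : V -> V) (H' : V -> Prop) : Prop :=
  exists K : V -> Prop, [/\ subalgebra br K, (forall x, K x -> H x /\ H' x),
    finite_codim L K & (forall x, K x -> h x = h' x)].

Lemma admissible_multiplier_in_Q (h : V -> V) (H : V -> Prop) :
  admissible_pair br L h H -> exists f, multiplier_in_Q h H f.
Proof.
move=> /admissible_multiplier [r [s [rA sA s0 M]]].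
by exists (r, s); split=> //; apply: inA_fraction.
Qed.

(** Commutativity is inherited from E: on the intersection of their domains, both composites
    multiply by the product of the two fractions. *)
Lemma pair_comp_comm (h1 h2 : V -> V) (H1 H2 : V -> Prop) :
  admissible_pair br L h1 H1 -> admissible_pair br L h2 H2 ->
  pair_equiv (fun x => h1 (h2 x)) (comp_dom H1 H2 h2)
             (fun x => h2 (h1 x)) (comp_dom H2 H1 h1).
Proof.
move=> a1 a2; have sub12 := comp_dom_subalgebra (proj1 a1) a2.
have sub21 := comp_dom_subalgebra (proj1 a2) a1.
have [H1L _] := proj2 a1.
exists (fun x => comp_dom H1 H2 h2 x /\ comp_dom H2 H1 h1 x); split=> //.
- exact: subalgebra_cap.
- apply: finite_codim_cap; [exact: (proj1 sub12) | exact: (proj1 sub21) | | |].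
  + by move=> x [/H1L].
  + exact: (comp_dom_codim a1 a2).
  exact: (comp_dom_codim a2 a1).
have [r [s [rA sA s0 M]]] := admissible_multiplier a1.
have [r' [s' [rA' sA' s0' M']]] := admissible_multiplier a2.
apply: (@multiplier_eq _ _ _ (r * r') (s * s') (r' * r) (s' * s)).
- exact: mulE_neq0.
- exact: mulE_neq0.
- by rewrite [s' * s]mulrC [r' * r]mulrC.
- apply: (multiplier_comp (H := H1)) => // x [[_ H2x H1h] _] //.
  exact: M'.
- apply: (multiplier_comp (H := H2)) => // x [_ [_ H1x H2h]] //.
  exact: M.
Qed.

Theorem multiplier_isomorphism : exists Phi : (V -> V) -> (V -> Prop) -> E * E,
  (forall h H, admissible_pair br L h H -> Q (Phi h H))
  /\ (forall h H h' H', admissible_pair br L h H -> admissible_pair br L h' H' ->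
      (pair_equiv h H h' H' <-> (Phi h H).1 * (Phi h' H').2 = (Phi h' H').1 * (Phi h H).2))
  /\ (forall f, Q f -> exists h H,
      admissible_pair br L h H /\ (Phi h H).1 * f.2 = f.1 * (Phi h H).2)
  /\ (forall c h H, admissible_pair br L h H ->
      (Phi (fun x => c *: h x) H).1 * (1 * (Phi h H).2)
      = zeta c%:P * (Phi h H).1 * (Phi (fun x => c *: h x) H).2)
  /\ (forall h1 H1 h2 H2, admissible_pair br L h1 H1 -> admissible_pair br L h2 H2 ->
      (Phi (fun x => h1 x + h2 x) (fun x => H1 x /\ H2 x)).1
        * ((Phi h1 H1).2 * (Phi h2 H2).2)
      = ((Phi h1 H1).1 * (Phi h2 H2).2 + (Phi h2 H2).1 * (Phi h1 H1).2)
        * (Phi (fun x => h1 x + h2 x) (fun x => H1 x /\ H2 x)).2)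
  /\ (forall h1 H1 h2 H2, admissible_pair br L h1 H1 -> admissible_pair br L h2 H2 ->
      (Phi (fun x => h1 (h2 x)) (comp_dom H1 H2 h2)).1 * ((Phi h1 H1).2 * (Phi h2 H2).2)
      = (Phi h1 H1).1 * (Phi h2 H2).1 * (Phi (fun x => h1 (h2 x)) (comp_dom H1 H2 h2)).2)
  /\ (Phi id L).1 * 1 = 1 * (Phi id L).2.
Proof.
(* The fraction is chosen for every pair that has a multiplier in Q, admissible or not, with default
   0/1. Sums and composites can then be evaluated by [Phi_eq], which asks for a multiplier on a
   subspace of finite codimension and not for the bracket identities. *)
have /choice [Phi PhiP] : forall hH : (V -> V) * (V -> Prop), exists f,
    (exists f', multiplier_in_Q hH.1 hH.2 f') -> multiplier_in_Q hH.1 hH.2 f.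
  move=> hH; have [[f Mf]|nM] := EM (exists f, multiplier_in_Q hH.1 hH.2 f).
    by exists f.
  by exists (0, 1).
have Phi_mult h H : admissible_pair br L h H -> multiplier_in_Q h H (Phi (h, H)).
  by move=> /admissible_multiplier_in_Q; apply: (PhiP (h, H)).
have Phi_eq h K f : finite_codim L K -> subspace_pred K -> multiplier_in_Q h K f ->
    (Phi (h, K)).1 * f.2 = f.1 * (Phi (h, K)).2.
  move=> codK subK Mf; have [|_ M] := PhiP (h, K); first by exists f.
  exact: (multiplier_unique codK subK M (proj2 Mf)).
have sub_mult r s h (H K : V -> Prop) : (forall x, K x -> H x) ->
    multiplier r s h H -> multiplier r s h K.
  by move=> KH M x /KH; apply: M.
exists (fun h H => Phi (h, H)); split; [|split; [|split; [|split; [|split; [|split]]]]].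
- by move=> h H /Phi_mult [].
- move=> h H h' H' a a'; have [[f0 _] M] := Phi_mult _ _ a.
  have [[f0' _] M'] := Phi_mult _ _ a'; split.
    move=> [K [[subK _] KHH' codK Ehh']]; apply: (multiplier_unique codK subK).
      by apply: sub_mult M => x /KHH' [].
    by move=> x Kx; rewrite Ehh' //; apply: M'; case: (KHH' _ Kx).
  move=> Er; exists (fun x => H x /\ H' x); split=> //.
  + by apply: subalgebra_cap; [case: a | case: a'].
  + exact: (admissible_pair_cap a a').
  apply: (multiplier_eq f0 f0' Er).
    by apply: sub_mult M => x [].
  by apply: sub_mult M' => x [].
- move=> f Qf; have [f0 [a [b [aA bA b0 Ef]]]] := Qf.
  have [h [H [adm M]]] := multiplier_exists aA bA b0.
  exists h, H; split=> //; have [[subH _] [_ [codH _]]] := adm.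
  apply: Phi_eq => //; split=> // x Hx; apply: (esc_inj b0).
  by rewrite escCA M // !escA [f.2 * a]mulrC -Ef [b * f.1]mulrC.
- move=> c h H adm; have [Qh M] := Phi_mult _ _ adm.
  have [[subH _] [_ [codH _]]] := adm.
  apply: (Phi_eq _ _ (zeta c%:P * (Phi (h, H)).1, 1 * (Phi (h, H)).2)) => //; split.
    apply: (function_field_mul (f := (zeta c%:P, 1))) => //.
    apply: inA_fraction; [exact: inA_zeta | exact: inA1 | exact: oner_neq0].
  by move=> x Hx; rewrite /= mul1r escZ M // -escA esc_zetaC.
- move=> h1 H1 h2 H2 a1 a2; have [Q1 M1] := Phi_mult _ _ a1.
  have [Q2 M2] := Phi_mult _ _ a2.
  set f1 := Phi (h1, H1) in Q1 M1 *; set f2 := Phi (h2, H2) in Q2 M2 *.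
  apply: (Phi_eq _ _ (f1.1 * f2.2 + f2.1 * f1.2, f1.2 * f2.2)).
  + exact: (admissible_pair_cap a1 a2).
  + exact: (proj1 (subalgebra_cap (proj1 a1) (proj1 a2))).
  split; first exact: function_field_add.
  apply: multiplier_sum; first by apply: sub_mult M1 => x [].
  by apply: sub_mult M2 => x [].
- move=> h1 H1 h2 H2 a1 a2; have [Q1 M1] := Phi_mult _ _ a1.
  have [Q2 M2] := Phi_mult _ _ a2.
  set f1 := Phi (h1, H1) in Q1 M1 *; set f2 := Phi (h2, H2) in Q2 M2 *.
  apply: (Phi_eq _ _ (f1.1 * f2.1, f1.2 * f2.2)).
  + exact: (comp_dom_codim a1 a2).
  + exact: (proj1 (comp_dom_subalgebra (proj1 a1) a2)).
  split; first exact: function_field_mul.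
  apply: (multiplier_comp _ M1); first by move=> x [].
  by apply: sub_mult M2 => x [].
apply: (Phi_eq _ _ (1, 1)).
- exists 0%N, (fun=> 0); split=> [[]//|x Lx].
  by exists (fun=> 0), x; rewrite big_ord0 add0r.
- exact: (proj1 subL).
by split=> //; apply: inA_fraction; [exact: inA1 | exact: inA1 | exact: oner_neq0].
Qed.

End FiniteCodimSubalgebra.

End Cover.

(** * The C-module of tensors and the maps from C[v_1] and C[z] to E *)

Section TensModule.
Local Open Scope quotient_scope.
Variables e1 e2 e3 : CC.
Local Notation E := (EE e1 e2 e3).

Definition iota_poly : {poly CC} -> E := (\pi_E \o polyC) \o polyC.
HB.instance Definition _ := GRing.RMorphism.copy iota_poly ((\pi_E \o polyC) \o polyC).

(** Since z = v_1^2 + e_1, the element p(z) is computed inside C[v_1], and injectivity reduces to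
    that of [iota_poly]. *)
Definition zeta_poly : {poly CC} -> E := iota_poly \o comp_poly ('X^2 + e1%:P).
HB.instance Definition _ := GRing.RMorphism.copy zeta_poly (iota_poly \o comp_poly ('X^2 + e1%:P)).

HB.instance Definition _ := gen_eqMixin (tens e1 e2 e3).
HB.instance Definition _ := gen_choiceMixin (tens e1 e2 e3).

Definition topp (x : tens e1 e2 e3) := Tens (- t1 x) (- t2 x) (- t3 x).

Lemma tens_ext_eq (x y : tens e1 e2 e3) :
  t1 x = t1 y -> t2 x = t2 y -> t3 x = t3 y -> x = y.
Proof. by case: x y => [? ? ?] [? ? ?] /= -> -> ->. Qed.

Lemma taddA : associative (@tadd e1 e2 e3).
Proof. by move=> x y z; apply: tens_ext_eq; apply: addrA. Qed.
Lemma taddC : commutative (@tadd e1 e2 e3).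
Proof. by move=> x y; apply: tens_ext_eq; apply: addrC. Qed.
Lemma tadd0 : left_id (@tzero e1 e2 e3) (@tadd e1 e2 e3).
Proof. by move=> x; apply: tens_ext_eq; apply: add0r. Qed.
Lemma taddN : left_inverse (@tzero e1 e2 e3) topp (@tadd e1 e2 e3).
Proof. by move=> x; apply: tens_ext_eq; apply: addNr. Qed.

HB.instance Definition _ := GRing.isZmodule.Build (tens e1 e2 e3) taddA taddC tadd0 taddN.

Lemma tscaleA a b (x : tens e1 e2 e3) : tscale a (tscale b x) = tscale (a * b) x.
Proof.
have cM u : cE e1 e2 e3 a * (cE e1 e2 e3 b * u) = cE e1 e2 e3 (a * b) * u.
  rewrite mulrA; congr (_ * u).
  exact (esym (etrans (congr1 iota_poly (polyCM a b)) (rmorphM iota_poly _ _))).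
by apply: tens_ext_eq; exact (cM _).
Qed.
Lemma tscale1 (x : tens e1 e2 e3) : tscale 1 x = x.
Proof.
have c1 u : cE e1 e2 e3 1 * u = u.
  by rewrite -[RHS]mul1r; congr (_ * u); exact (rmorph1 iota_poly).
by apply: tens_ext_eq; exact (c1 _).
Qed.
Lemma tscaleDr c (x y : tens e1 e2 e3) :
  tscale c (x + y) = tscale c x + tscale c y.
Proof. by apply: tens_ext_eq; exact (mulrDr _ _ _). Qed.
Lemma tscaleDl (x : tens e1 e2 e3) a b : tscale (a + b) x = tscale a x + tscale b x.
Proof.
have cD u : cE e1 e2 e3 (a + b) * u = cE e1 e2 e3 a * u + cE e1 e2 e3 b * u.
  rewrite -mulrDl; congr (_ * u).
  exact (etrans (congr1 iota_poly (polyCD a b)) (rmorphD iota_poly _ _)).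
by apply: tens_ext_eq; exact (cD _).
Qed.

HB.instance Definition _ := GRing.Zmodule_isLmodule.Build CC (tens e1 e2 e3)
  tscaleA tscale1 tscaleDr tscaleDl.

End TensModule.

(** * The ring E as an instance of the abstract setting *)

Section Instance.
Local Open Scope quotient_scope.
Variables e1 e2 e3 : CC.
Local Notation E := (EE e1 e2 e3).
Local Notation iota := (iota_poly e1 e2 e3).
Local Notation zeta := (zeta_poly e1 e2 e3).

Lemma gen_eq (i j : 'I_3) : \pi_E (gen e1 e2 e3 i) = \pi_E (gen e1 e2 e3 j).
Proof.
apply/eqP; rewrite -Quotient.idealrBE; apply/asboolP.
exists (fun k l => ((k == i) && (l == j))%:R).
rewrite (bigD1 i) //= (bigD1 j) //= !eqxx mul1r !big1 ?addr0 //.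
  by move=> k /negPf ki; rewrite big1 // => l _; rewrite ki mul0r.
by move=> l /negPf lj; rewrite lj andbF mul0r.
Qed.

Lemma pi_sqr_cst (p : PP) c : \pi_E (p ^+ 2 + pcst c) = \pi_E p ^+ 2 + cE e1 e2 e3 c.
Proof.
exact (etrans (rmorphD \pi_E _ _) (congr1 (fun x => x + _) (rmorphXn \pi_E 2 p))).
Qed.

Lemma vh2_sqr_vh1 : vh2 e1 e2 e3 ^+ 2 + cE e1 e2 e3 e2 = vh1 e1 e2 e3 ^+ 2 + cE e1 e2 e3 e1.
Proof.
exact (etrans (esym (pi_sqr_cst _ _)) (etrans (gen_eq 1 0) (pi_sqr_cst _ _))).
Qed.

Lemma vh3_sqr_vh1 : vh3 e1 e2 e3 ^+ 2 + cE e1 e2 e3 e3 = vh1 e1 e2 e3 ^+ 2 + cE e1 e2 e3 e1.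
Proof.
exact (etrans (esym (pi_sqr_cst _ _)) (etrans (gen_eq 2%:R 0) (pi_sqr_cst _ _))).
Qed.

(** Every t is the first coordinate of a point at which all v_i^2 + e_i equal t^2 + e_1, because
    square roots exist. The ideal vanishes at that point, so a polynomial in v_1 lying in the ideal
    vanishes at every t. *)
Lemma iota_inj p : iota p = 0 -> p = 0.
Proof.
move=> p0.
have : \pi_E (p%:P%:P : PP) = \pi_E (0 : PP) by rewrite (rmorph0 \pi_E).
move/eqP; rewrite -Quotient.idealrBE subr0 => /asboolP [a Ha].
apply: poly_eq0_pointwise => t.
pose x i := sqrtC (t ^+ 2 + e1 - [:: e1; e2; e3]`_i).
have key (i : 'I_3) : pev t (x 1%N) (x 2%N) (gen e1 e2 e3 i) = t ^+ 2 + e1.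
  case: i => [[|[|[|k]]] Hk] //=;
    by rewrite /gen /= ?pevD /pev ?hornerE /x /= -?expr2 ?sqrtCK ?subrK.
have hs (G : 'I_3 -> PP) : pev t (x 1%N) (x 2%N) (\sum_(i < 3) G i) =
    \sum_(i < 3) pev t (x 1%N) (x 2%N) (G i).
  by rewrite !big_ord_recr !big_ord0 /= !pevD /pev !hornerE.
have -> : p.[t] = pev t (x 1%N) (x 2%N) (p%:P%:P) by rewrite /pev !hornerE.
rewrite Ha hs big1 // => i _; rewrite hs big1 // => j _.
by rewrite pevM pevB !key subrr mulr0.
Qed.

Lemma zeta_polyE p : zeta p = iota (p \Po ('X^2 + e1%:P)). Proof. by []. Qed.

Lemma zeta_polyC c : zeta c%:P = cE e1 e2 e3 c.
Proof. by rewrite zeta_polyE comp_polyC. Qed.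

Lemma iotaX2D c : iota ('X^2 + c%:P) = vh1 e1 e2 e3 ^+ 2 + cE e1 e2 e3 c.
Proof. by rewrite (rmorphD iota) (rmorphXn iota). Qed.

Lemma zeta_polyX : zeta 'X = zE e1 e2 e3.
Proof. by rewrite zeta_polyE comp_polyX iotaX2D. Qed.

Lemma zeta_poly_inj p : zeta p = 0 -> p = 0.
Proof.
rewrite zeta_polyE => /iota_inj /eqP; rewrite comp_poly_eq0; first by move/eqP.
by rewrite size_X2D.
Qed.

Lemma zeta_XsubC c : zeta ('X - c%:P) = vh1 e1 e2 e3 ^+ 2 + cE e1 e2 e3 e1 - cE e1 e2 e3 c.
Proof.
exact: etrans (rmorphB zeta _ _) (congr2 (fun a b => a - b) zeta_polyX (zeta_polyC c)).
Qed.

Lemma zeta_XsubC_iota c : zeta ('X - c%:P) = iota ('X^2 + (e1 - c)%:P).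
Proof. by rewrite zeta_polyE comp_polyB comp_polyX comp_polyC -addrA -polyCB. Qed.

Lemma vh1_sqr : vh1 e1 e2 e3 ^+ 2 = zeta ('X - e1%:P).
Proof. by rewrite zeta_XsubC addrK. Qed.
Lemma vh2_sqr : vh2 e1 e2 e3 ^+ 2 = zeta ('X - e2%:P).
Proof. by rewrite zeta_XsubC -vh2_sqr_vh1 addrK. Qed.
Lemma vh3_sqr : vh3 e1 e2 e3 ^+ 2 = zeta ('X - e3%:P).
Proof. by rewrite zeta_XsubC -vh3_sqr_vh1 addrK. Qed.

Hypotheses (e12 : e1 != e2) (e13 : e1 != e3) (e23 : e2 != e3).

(** Over C[v_1] the squares of v_2 and v_3 are v_1^2 + (e_1 - e_2) and v_1^2 + (e_1 - e_3); the two
    constants are nonzero and distinct exactly when the e_i are pairwise distinct. *)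
Lemma EE_domain (x y : E) : x * y = 0 -> x = 0 \/ y = 0.
Proof.
have sq2 : vh2 e1 e2 e3 ^+ 2 = iota ('X^2 + (e1 - e2)%:P).
  by rewrite vh2_sqr zeta_XsubC_iota.
have sq3 : vh3 e1 e2 e3 ^+ 2 = iota ('X^2 + (e1 - e3)%:P).
  by rewrite vh3_sqr zeta_XsubC_iota.
apply: (biquad_quotient_domain (pi := (\pi_E : {rmorphism PP -> E}))
  _ _ _ iota_inj _ sq2 sq3).
- by rewrite subr_eq0.
- by rewrite subr_eq0.
- by rewrite (inj_eq (addrI _)) eqr_opp.
by elim/quotW=> p; exists p.
Qed.

Lemma t1_tscale c (x : tens e1 e2 e3) : t1 (c *: x) = zeta c%:P * t1 x.
Proof. by rewrite zeta_polyC. Qed.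
Lemma t2_tscale c (x : tens e1 e2 e3) : t2 (c *: x) = zeta c%:P * t2 x.
Proof. by rewrite zeta_polyC. Qed.
Lemma t3_tscale c (x : tens e1 e2 e3) : t3 (c *: x) = zeta c%:P * t3 x.
Proof. by rewrite zeta_polyC. Qed.

Lemma tens_eta (x : tens e1 e2 e3) : Tens (t1 x) (t2 x) (t3 x) = x.
Proof. by case: x. Qed.

Definition tens_cover : so3_cover E (tens e1 e2 e3) :=
  @So3Cover _ _ _ zeta e1 e2 e3 (vh1 e1 e2 e3) (vh2 e1 e2 e3) (vh3 e1 e2 e3)
  (@Tens e1 e2 e3) (@t1 e1 e2 e3) (@t2 e1 e2 e3) (@t3 e1 e2 e3) (@tbr e1 e2 e3)
  zeta_poly_inj EE_domain e12 e13 vh1_sqr vh2_sqr vh3_sqr tens_eta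
  (fun _ _ _ => erefl) (fun _ _ _ => erefl) (fun _ _ _ => erefl)
  (fun _ _ => erefl) (fun _ _ => erefl) (fun _ _ => erefl)
  t1_tscale t2_tscale t3_tscale
  (fun _ _ => erefl) (fun _ _ => erefl) (fun _ _ => erefl).

End Instance.

(** * Identification of Q and transfer of the isomorphism *)

(** The fractions of A form a subfield containing z and y, and [function_field_generated] places
    them in any other such subfield. *)
Lemma Qmem_function_field (e1 e2 e3 : CC) (e12 : e1 != e2) (e13 : e1 != e3) (e23 : e2 != e3)
    (f : Defs.frac e1 e2 e3) :
  Qmem f <-> in_function_field (tens_cover e12 e13 e23) f.
Proof.
set (m := tens_cover e12 e13 e23).
split.
  intros [_ inS]; refine (inS (in_function_field m) _ _ _).
  - refine (conj _ (conj _ (conj _ (conj _ (conj _ (conj _ _)))))).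
    + exact (fun g Qg => proj1 Qg).
    + exact (fun g g' Qg => function_field_eq Qg).
    + exact (fun c => eq_ind _ (fun x => in_function_field m (x, 1))
        (inA_fraction (inA_zeta m c%:P) (inA1 m) (oner_neq0 _)) _ (zeta_polyC e1 e2 e3 c)).
    + exact (@function_field_add _ _ _ m).
    + exact (@function_field_opp _ _ _ m).
    + exact (@function_field_mul _ _ _ m).
    exact (@function_field_inv _ _ _ m).
  - exact (eq_ind _ (fun x => in_function_field m (x, 1))
      (inA_fraction (inA_zeta m 'X) (inA1 m) (oner_neq0 _)) _ (zeta_polyX e1 e2 e3)).
  exact (inA_fraction (inA_y m) (inA1 m) (oner_neq0 _)).
intros Qf; refine (conj (proj1 Qf) _).
intros S [_ [Seq [Sc [SD [_ [SM SV]]]]]] Sz Sy.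
refine (@function_field_generated _ _ _ m S Seq _ SD SM SV _ Sy f Qf).
  exact (fun c => eq_ind_r (fun x => S (x, 1)) (Sc c) (zeta_polyC e1 e2 e3 c)).
exact (eq_ind_r (fun x => S (x, 1)) Sz (zeta_polyX e1 e2 e3)).
Qed.

Theorem theorem6p8 (e1 e2 e3 : CC) :
  e1 != e2 -> e1 != e3 -> e2 != e3 ->
  forall L : tens e1 e2 e3 -> Prop,
    is_subalg L -> (forall x, L x -> RR x) -> fincodim (@RR e1 e2 e3) L ->
    (forall h1 H1 h2 H2, admissible L h1 H1 -> admissible L h2 H2 ->
       ap_equiv L (hcomp h1 h2) (Hhat H1 H2 h2) (hcomp h2 h1) (Hhat H2 H1 h1)) /\
    exists Phi, IL_iso_Q L Phi.
Proof.
intros e12 e13 e23 L subL LR codL.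
set (m := tens_cover e12 e13 e23).
split.
  exact (fun h1 H1 h2 H2 => @pair_comp_comm _ _ _ m L LR codL h1 h2 H1 H2).
destruct (@multiplier_isomorphism _ _ _ m L subL LR codL)
  as [Phi [PQ [Peq [Psurj [PZ [PD [PM P1]]]]]]].
exists Phi; refine (conj _ (conj _ (conj _ (conj _ (conj _ (conj _ _)))))).
- exact (fun h H adm => proj2 (Qmem_function_field e12 e13 e23 _) (PQ h H adm)).
- exact Peq.
- exact (fun f Qf => Psurj f (proj1 (Qmem_function_field e12 e13 e23 f) Qf)).
- exact (fun c h H adm => eq_ind _ (fun x => feq _ (fmul (x, 1) (Phi h H)))
    (PZ c h H adm) _ (zeta_polyC e1 e2 e3 c)).
- exact PD.
- exact PM.
exact P1.
Qed.
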